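(* Let $(G,H)$ be a reduced directed Hecke pair, and suppose that $H$ is normal in $N$ and $N$ is normal in $G$ for some subgroup $N$ of $G$. Let $(\overline G,\overline H)$ be the Schlichting completion, $\overline N$ the closure of $N$ in $\overline G$, $p=\chi_{\overline H}$, and let $I$ be the closed ideal of $C^*(\overline N)$ generated by $\{xpx^{-1}:x\in G\}$. Then $I=C^*(\overline N)$. Moreover, the group action $(C^*(\overline N),G,\mathrm{Ad})$ is the minimal automorphic dilation of the semigroup action $(C^*(N/H),T,\beta)$.
   Context: $(G,H)$ ($H$ a subgroup of a group $G$) is a Hecke pair if every double coset $HxH$ is a finite union of left cosets of $H$; it is reduced if $\bigcap_{x\in G}xHx^{-1}=\{e\}$. Let $\mathrm{Map}(G/H)$ be the set of all maps $G/H\to G/H$ with the topology of pointwise convergence ($G/H$ discrete), and let $\theta(x)(yH)=xyH$. The Schlichting completion is $\overline G=\overline{\theta(G)}$, $\overline H=\overline{\theta(H)}$ (closures in $\mathrm{Map}(G/H)$); $\overline G$ is a locally compact group of permutations of $G/H$, $\overline H$ is a compact open subgroup, and $G$ is identified with the dense subgroup $\theta(G)$. Left Haar measure on $\overline G$ is normalized so that $\overline H$ has measure $1$, and $\overline N$ (an open normal subgroup of $\overline G$ containing $\overline H$ as a normal subgroup) carries the restricted Haar measure; then $p=\chi_{\overline H}$ is a central projection in $C^*(\overline N)$. The pair is directed if $G=T^{-1}T$, where $T=\{t\in G:tHt^{-1}\supseteq H\}$ (a semigroup). $\mathrm{Ad}$ denotes the action of $G$ on $C^*(\overline N)$ induced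 by conjugation of $G$ on $\overline N$; in particular $xpx^{-1}=\mathrm{Ad}\,x(p)$. Let $\Delta(x)=L(x)/L(x^{-1})$ with $L(x)=|HxH/H|$ (this is the restriction to $G$ of the modular function of $\overline G$). For $n\in N$ write $\chi_{nH}$ for the canonical unitary generator of $C^*(N/H)$ corresponding to $nH\in N/H$, and for a finite union $S$ of cosets write $\chi_S=\sum_{kH\subseteq S}\chi_{kH}$. The semigroup action $\beta:T\to\mathrm{End}\,C^*(N/H)$ is determined by $\beta_t(\chi_{nH})=\Delta(t)\chi_{tnHt^{-1}}$ (for $t \in T$, $tnHt^{-1}$ is a finite union of left cosets of $H$ in $N$). Let $i:C^*(N/H)\to C^*(\overline N)$ be the injective homomorphism determined by $i(\chi_{nH})=\chi_{n\overline H}=np$ (the composition of the isomorphism $C^*(N/H)\cong C^*(\overline N/\overline H)$ with the isomorphism $C^*(\overline N/\overline H)\cong pC^*(\overline N)$). That $(C^*(\overline N),G,\mathrm{Ad})$ is the minimal automorphic dilation of $(C^*(N/H),T,\beta)$ (in the sense of Laca) means that $\mathrm{Ad}$ is an action by automorphisms with $\mathrm{Ad}\,t\circ i=i\circ\beta_t$ for all $t\in T$, and the closed linear span of $\bigcup_{t\in T}(\mathrm{Ad}\,t)^{-1}\bigl(i(C^*(N/H))\bigr)$ is $C^*(\overline N)$. *)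

(* Defs.v *)
From HB Require Import structures.
From mathcomp Require Import all_boot all_order all_algebra finmap complex.
From mathcomp Require Import all_classical all_reals all_analysis.

Set Implicit Arguments.
Unset Strict Implicit.
Unset Printing Implicit Defensive.

Import Order.TTheory GRing.Theory Num.Theory numFieldNormedType.Exports.

Local Open Scope classical_set_scope.
Local Open Scope ring_scope.
Local Open Scope complex_scope.

Section Cosets.
Variable G : groupType.
Implicit Types H N : set G.

Definition subgroup H :=
  [/\ H 1%g, forall x y, H x -> H y -> H (x * y)%g & forall x, H x -> H x^-1%g].

Definition normal_subgroup H N :=
  [/\ subgroup H, subgroup N, H `<=` N &
      forall n h, N n -> H h -> H (n * h * n^-1)%g].

Definition lcoset (x : G) (A : set G) : set G := [set (x * a)%g | a in A].

Definition conjset (x : G) (A : set G) : set G :=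
  [set (x * a * x^-1)%g | a in A].

Definition lcosets H : set (set G) := range (lcoset ^~ H).

(* The left cosets of H contained in HxH, i.e. HxH/H. *)
Definition double_coset H (x : G) : set (set G) :=
  [set lcoset (h * x)%g H | h in H].

Definition hecke_pair H :=
  subgroup H /\ forall x, finite_set (double_coset H x).

Definition reduced H := \bigcap_x conjset x H = [set 1%g].

(* The semigroup T. *)
Definition dirsemi H : set G := [set t | H `<=` conjset t H].

Definition directed H :=
  forall x, exists s t, [/\ dirsemi H s, dirsemi H t & x = (s^-1 * t)%g].

Definition hindex H (x : G) : nat := #|` fset_set (double_coset H x)|%fset.

Definition Delta (R : realType) H (x : G) : R :=
  (hindex H x)%:R / (hindex H x^-1%g)%:R.

Lemma lcosetM x y A : lcoset x (lcoset y A) = lcoset (x * y)%g A.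
Proof.
apply/seteqP; split=> z.
  by case=> _ [a Aa <-] <-; exists a; rewrite // mulgA.
by case=> a Aa <-; exists (y * a)%g; [exists a|rewrite mulgA].
Qed.

Lemma lcoset1 A : lcoset 1%g A = A.
Proof.
by apply/seteqP; split=> [z [a Aa <-]|z Az]; [rewrite mul1g|exists z; rewrite ?mul1g].
Qed.

Lemma lcoset_in H x (C : lcosets H) : lcosets H (lcoset x (val C)).
Proof.
have /set_mem [y _ <-] := valP C.
by exists (x * y)%g; rewrite // lcosetM.
Qed.

Definition theta H (x : G) (C : lcosets H) : lcosets H :=
  SigSub (mem_set (lcoset_in x C)).
Arguments theta : clear implicits.

Lemma thetaM H x y C : theta H x (theta H y C) = theta H (x * y)%g C.
Proof. by apply: val_inj; rewrite /= lcosetM. Qed.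

Lemma theta1 H C : theta H 1%g C = C.
Proof. by apply: val_inj; rewrite /= lcoset1. Qed.

End Cosets.
Arguments theta {G} H x C.

HB.mixin Record isTopologicalGroup X & Group X & PointedTopological X := {
  mulg_continuous : continuous (fun z : X * X => (z.1 * z.2)%g : X);
  invg_continuous : continuous (fun x : X => x^-1%g : X)
}.

#[short(type="topGroupType")]
HB.structure Definition TopologicalGroup :=
  {X of isTopologicalGroup X & Group X & PointedTopological X}.

Section MapSpace.
Variables (G : groupType) (H : set G).

Definition MapGH : topologicalType :=
  {ptws (lcosets H : Type) -> discrete_topology (lcosets H)}.

Lemma nbhs_MapGH (g : MapGH) (U : set MapGH) :
  nbhs g U <-> exists F : seq (lcosets H),
                 [set h : MapGH | {in F, h =1 g}] `<=` U.
Proof.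
split=> [|[F FU]]; last first.
  apply: filterS FU _; elim: F => [|c F IHF].
    by apply: filterS filterT => h _ c; rewrite in_nil.
  have gc : nbhs g [set h : MapGH | h c = g c].
    have /(_ [set g c]) := @proj_continuous (lcosets H)
      (fun=> discrete_topology (lcosets H)) c g.
    by apply; exact: discrete_set1.
  apply: filterS (filterI gc IHF) => h [hc hF] d.
  by rewrite in_cons => /orP[/eqP->//|/hF].
set B := filter_from setT (fun F : seq (lcosets H) =>
  [set h : MapGH | {in F, h =1 g}]).
have BF : Filter B.
  apply: filter_from_filter; first by exists [::].
  move=> F1 F2 _ _; exists (F1 ++ F2) => // h hF.
  by split=> c cF; apply: hF; rewrite mem_cat cF ?orbT.
suff: B --> g by move=> /[apply] -[F _ FU]; exists F.
apply/cvg_sup => c A; rewrite nbhsE => -[_ [[C Cop <-] Cg] CA].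
exists [:: c] => // h hc; apply: CA => /=.
by rewrite hc ?mem_head.
Qed.

Lemma closure_MapGH (S : set MapGH) (g : MapGH) :
  closure S g <-> forall F : seq (lcosets H), exists2 s, S s & {in F, s =1 g}.
Proof.
split=> [Sg F|Sg U /nbhs_MapGH[F FU]]; last first.
  by have [s Ss sg] := Sg F; exists s; split=> //; exact: FU.
have /Sg [s [Ss sg]] : nbhs g [set h : MapGH | {in F, h =1 g}].
  by apply/nbhs_MapGH; exists F.
by exists s.
Qed.
End MapSpace.

Section ClosureG.
Variables (G : groupType) (H : set G).

Local Notation map := (MapGH H).

Definition closureG : set map := closure (range (theta H : G -> map)).

Lemma closureGP (g : map) :
  closureG g <-> forall F : seq (lcosets H), exists x, {in F, theta H x =1 g}.
Proof.
split=> [/closure_MapGH gP F|gP]; last first.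
  by apply/closure_MapGH => F; have [x xg] := gP F; exists (theta H x).
by have [_ [x _ <-] xg] := gP F; exists x.
Qed.

Lemma closureG_id : closureG idfun.
Proof. by apply/closureGP => F; exists 1%g => c _; rewrite theta1. Qed.

Lemma closureG_theta x : closureG (theta H x).
Proof. by apply/closureGP => F; exists x. Qed.

Lemma closureG_comp (g h : map) :
  closureG g -> closureG h -> closureG (g \o h).
Proof.
move=> /closureGP gP /closureGP hP; apply/closureGP => F.
have [y yh] := hP F; have [x xg] := gP [seq h c | c <- F].
exists (x * y)%g => c cF; rewrite -thetaM yh //= xg //.
by rewrite map_f.
Qed.

Lemma closureG_inj (g : map) : closureG g -> injective g.
Proof.
move=> /closureGP gP c d; have [x xg] := gP [:: c; d].
rewrite -!xg ?inE ?eqxx ?orbT // => /(congr1 (theta H x^-1%g)).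
by rewrite !thetaM mulVg !theta1.
Qed.

Definition trivial_coset : lcosets H :=
  SigSub (mem_set (imageP (fun x : G => lcoset x H) (I : [set: G] 1%g))).

Lemma coset_stab x : subgroup H ->
  theta H x trivial_coset = trivial_coset -> H x.
Proof.
move=> [H1 _ _] /(congr1 val) /=; rewrite lcosetM mulg1 lcoset1 => <-.
by exists 1%g; rewrite ?mulg1.
Qed.

Lemma horbit_finite c : hecke_pair H ->
  finite_set [set theta H h c | h in H].
Proof.
move=> [_ heckeH]; have /set_mem [y _ yc] := valP c.
apply: sub_finite_set (finite_image (insubd trivial_coset) (heckeH y)).
move=> _ [h Hh <-]; exists (lcoset (h * y)%g H); first by exists h.
by rewrite -lcosetM yc; apply: val_inj; rewrite val_insubd mem_set //; exact: lcoset_in.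
Qed.

Lemma closureG_surj (g : map) : hecke_pair H -> closureG g ->
  forall c, exists d, g d = c.
Proof.
move=> heckeH gcl c0; have [sH _] := heckeH.
have /closureGP /(_ [:: trivial_coset]) [x xg] := gcl.
pose k : map := theta H x^-1%g \o g.
have kcl : closureG k by apply: closureG_comp => //; exact: closureG_theta.
have k0 : k trivial_coset = trivial_coset.
  by rewrite /k /= -xg ?inE // thetaM mulVg theta1.
pose c := theta H x^-1%g c0.
pose O := [set theta H h c | h in H].
have finO : finite_set O by exact: horbit_finite.
have kO d : O d -> O (k d).
  move=> [h Hh <-]; have /closureGP := kcl.
  move=> /(_ [:: trivial_coset; theta H h c])[z zk].
  have Hz : H z by apply: coset_stab => //; rewrite zk ?inE ?eqxx.
  rewrite -zk ?inE ?eqxx ?orbT // thetaM.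
  by exists (z * h)%g => //; have [_ + _] := sH; apply.
have kinj : injective k by exact: closureG_inj.
have : (k @` fset_set O)%fset = fset_set O.
  apply/eqP; rewrite eqEfcard card_imfset //= leqnn andbT.
  apply/fsubsetP => _ /imfsetP[d /= + ->].
  by rewrite !in_fset_set // !inE; exact: kO.
have Oc : O c by exists 1%g; [have [] := sH|rewrite theta1].
move=> kOO; have : c \in fset_set O by rewrite in_fset_set ?inE.
rewrite -kOO => /imfsetP[d _ /(congr1 (theta H x))].
rewrite /c /k /= !thetaM !mulgV !theta1 => ->.
by exists d.
Qed.

(* The inverse permutation; its values are unspecified off [closureG]. *)
Definition minv (g : map) : map := fun c => xget c [set d | g d = c].

Lemma minvK (g : map) : hecke_pair H -> closureG g -> g \o minv g = idfun.
Proof.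
move=> heckeH gcl; apply/funext => c /=; rewrite /minv.
by case: xgetP => // nod; have [d /nod] := closureG_surj heckeH gcl c.
Qed.

Lemma minvKV (g : map) : hecke_pair H -> closureG g -> minv g \o g = idfun.
Proof.
move=> heckeH gcl; apply/funext => c; apply: (closureG_inj gcl).
by have /(congr1 (@^~ (g c))) := minvK heckeH gcl.
Qed.

Lemma closureG_minv (g : map) : hecke_pair H -> closureG g ->
  closureG (minv g).
Proof.
move=> heckeH gcl; apply/closureGP => F.
have /closureGP /(_ [seq minv g c | c <- F]) [x xg] := gcl.
exists x^-1%g => c cF.
have := xg (minv g c) (map_f _ cF).
have /(congr1 (@^~ c)) /= -> := minvK heckeH gcl.
by move=> {1}<-; rewrite thetaM mulVg theta1.
Qed.
End ClosureG.
Arguments closureG {G} H _.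
Arguments trivial_coset {G} H.

Definition schlichting (G : groupType) (H : set G) (heckeH : hecke_pair H)
  : Type := set_type (closureG H).

Section Schlichting.
Variables (G : groupType) (H : set G) (heckeH : hecke_pair H).

Local Notation Gbar := (schlichting heckeH).

HB.instance Definition _ := Topological.copy Gbar (set_type (closureG H)).

Definition emb (x : G) : Gbar := SigSub (mem_set (@closureG_theta G H x)).

Definition sch_one : Gbar := SigSub (mem_set (@closureG_id G H)).
Definition sch_mul (g h : Gbar) : Gbar :=
  SigSub (mem_set (closureG_comp (set_mem (valP g)) (set_mem (valP h)))).
Definition sch_inv (g : Gbar) : Gbar :=
  SigSub (mem_set (closureG_minv heckeH (set_mem (valP g)))).

Lemma sch_mulA : associative sch_mul.
Proof. by move=> x y z; exact: val_inj. Qed.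
Lemma sch_mul1 : left_id sch_one sch_mul.
Proof. by move=> x; exact: val_inj. Qed.
Lemma sch_mulr1 : right_id sch_one sch_mul.
Proof. by move=> x; exact: val_inj. Qed.
Lemma sch_mulV : left_inverse sch_one sch_inv sch_mul.
Proof.
by move=> x; apply: val_inj; apply: (minvKV heckeH); exact: set_mem (valP x).
Qed.
Lemma sch_mulrV : right_inverse sch_one sch_inv sch_mul.
Proof.
by move=> x; apply: val_inj; apply: (minvK heckeH); exact: set_mem (valP x).
Qed.

HB.instance Definition _ := isGroup.Build Gbar
  sch_mulA sch_mul1 sch_mulr1 sch_mulV sch_mulrV.
HB.instance Definition _ := isPointed.Build Gbar sch_one.

Lemma nbhs_sch (g : Gbar) (U : set Gbar) :
  nbhs g U <-> exists F : seq (lcosets H),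
     [set h : Gbar | {in F, (val h : MapGH H) =1 (val g : MapGH H)}] `<=` U.
Proof.
split=> [|[F FU]].
  rewrite nbhsE => -[_ [[C Cop <-] Cg] CU].
  have /nbhs_MapGH [F FC] : nbhs (val g : MapGH H) C by exact: open_nbhs_nbhs.
  by exists F => h hF; apply: CU; apply: FC.
have gF : nbhs (val g : MapGH H) [set h : MapGH H | {in F, h =1 (val g : MapGH H)}].
  by apply/nbhs_MapGH; exists F.
apply: filterS FU _.
exact: (@initial_continuous (set_type (closureG H)) _ set_val g _ gF).
Qed.

Lemma sch_mul_continuous : continuous (fun z : Gbar * Gbar => (z.1 * z.2)%g : Gbar).
Proof.
move=> [g h] U /nbhs_sch [F FU].
exists ([set g' : Gbar | {in [seq (val h : MapGH H) c | c <- F],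
           (val g' : MapGH H) =1 (val g : MapGH H)}],
        [set h' : Gbar | {in F, (val h' : MapGH H) =1 (val h : MapGH H)}]).
  by split; apply/nbhs_sch; eexists; exact: subset_refl.
move=> [g' h'] [/= g'g h'h]; apply: FU => c cF /=.
by rewrite h'h // g'g // map_f.
Qed.

Lemma sch_inv_continuous : continuous (fun x : Gbar => x^-1%g : Gbar).
Proof.
move=> g U /nbhs_sch [F FU]; apply/nbhs_sch.
exists [seq minv (val g) c | c <- F] => h hg; apply: FU => c cF /=.
have gcl := set_mem (valP g); have hcl := set_mem (valP h).
apply: (closureG_inj hcl).
have /(congr1 (@^~ c)) /= -> := minvK heckeH hcl.
have /= -> := hg _ (map_f _ cF).
by have /(congr1 (@^~ c)) /= -> := minvK heckeH gcl.
Qed.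

HB.instance Definition _ :=
  isTopologicalGroup.Build Gbar sch_mul_continuous sch_inv_continuous.

(* The closure in Map(G/H) of a subset of G, which lies in [Gbar]. *)
Definition bar (A : set G) : set Gbar :=
  [set g | closure (theta H @` A : set (MapGH H)) (val g)].
End Schlichting.
Arguments emb {G H} heckeH x.
Arguments bar {G H} heckeH A.

Section QuotientGroup.
Variables (G : groupType) (H N : set G).

Definition cosets_in : set (set G) := [set lcoset n H | n in N].

Hypothesis HN : normal_subgroup H N.

Definition setmul (A B : set G) : set G :=
  [set z | exists x y, [/\ A x, B y & z = (x * y)%g]].
Definition setinv (A : set G) : set G := [set x^-1%g | x in A].

Lemma setmul_lcoset n m : N m ->
  setmul (lcoset n H) (lcoset m H) = lcoset (n * m)%g H.
Proof.
have [[H1 HM HV] [_ _ NV] _ nHN] := HN => Nm.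
apply/seteqP; split=> z.
  case=> _ [_ [[h Hh <-] [k Hk <-] ->]]; exists (m^-1 * h * m * k)%g.
    by apply: HM => //; have := nHN _ _ (NV _ Nm) Hh; rewrite invgK.
  by rewrite !mulgA mulgK.
case=> h Hh <-; exists n, (m * h)%g; split; last by rewrite mulgA.
  by exists 1%g; rewrite ?mulg1.
by exists h.
Qed.

Lemma setinv_lcoset n : N n -> setinv (lcoset n H) = lcoset n^-1%g H.
Proof.
have [[H1 HM HV] [_ _ NV] _ nHN] := HN => Nn.
apply/seteqP; split=> z.
  case=> _ [h Hh <-] <-; exists (n * h^-1 * n^-1)%g; first exact/nHN/HV.
  by rewrite invgM !mulgA mulVg mul1g.
case=> h Hh <-; exists (n * (n^-1 * h^-1 * n))%g; last first.
  by rewrite !invgM !invgK !mulgA mulgK.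
exists (n^-1 * h^-1 * n)%g => //.
by have := nHN _ _ (NV _ Nn) (HV _ Hh); rewrite invgK.
Qed.

Lemma cosets_in_mul A B : cosets_in A -> cosets_in B -> cosets_in (setmul A B).
Proof.
have [_ [_ NM _] _ _] := HN => -[n Nn <-] [m Nm <-].
by rewrite setmul_lcoset //; exists (n * m)%g; rewrite //; exact: NM.
Qed.

Lemma cosets_in_inv A : cosets_in A -> cosets_in (setinv A).
Proof.
have [_ [_ _ NV] _ _] := HN => -[n Nn <-].
by rewrite setinv_lcoset //; exists n^-1%g; rewrite //; exact: NV.
Qed.

Lemma cosets_in_one : cosets_in H.
Proof. by have [_ [N1 _ _] _ _] := HN; exists 1%g; rewrite ?lcoset1. Qed.
End QuotientGroup.

Definition quotient_group (G : groupType) (H N : set G)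
  (HN : normal_subgroup H N) : Type := set_type (cosets_in H N).

Section QuotientGroupType.
Variables (G : groupType) (H N : set G) (HN : normal_subgroup H N).

Local Notation Q := (quotient_group HN).

HB.instance Definition _ := Choice.copy Q (set_type (cosets_in H N)).

Definition quo_one : Q := SigSub (mem_set (cosets_in_one HN)).
Definition quo_mul (A B : Q) : Q :=
  SigSub (mem_set (cosets_in_mul HN (set_mem (valP A)) (set_mem (valP B)))).
Definition quo_inv (A : Q) : Q :=
  SigSub (mem_set (cosets_in_inv HN (set_mem (valP A)))).

Lemma quo_mulA : associative quo_mul.
Proof.
move=> A B C; apply: val_inj => /=; apply/seteqP; split=> z.
  case=> a [_ [Aa [b [c [Bb Cc ->]]] ->]]; exists (a * b)%g, c.
  by split; rewrite ?mulgA //; exists a, b.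
case=> _ [c [[a [b [Aa Bb ->]]] Cc ->]]; exists a, (b * c)%g.
by split; rewrite ?mulgA //; exists b, c.
Qed.
Lemma quo_mul1 : left_id quo_one quo_mul.
Proof.
move=> A; apply: val_inj => /=; have /set_mem [n Nn <-] := valP A.
by rewrite -{1}(lcoset1 H) (setmul_lcoset HN) // mul1g.
Qed.
Lemma quo_mulr1 : right_id quo_one quo_mul.
Proof.
move=> A; apply: val_inj => /=; have /set_mem [n Nn <-] := valP A.
have [_ [N1 _ _] _ _] := HN.
by rewrite -{2}(lcoset1 H) (setmul_lcoset HN) // mulg1.
Qed.
Lemma quo_mulV : left_inverse quo_one quo_inv quo_mul.
Proof.
move=> A; apply: val_inj => /=; have /set_mem [n Nn <-] := valP A.
by rewrite (setinv_lcoset HN) // (setmul_lcoset HN) // mulVg lcoset1.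
Qed.
Lemma quo_mulrV : right_inverse quo_one quo_inv quo_mul.
Proof.
move=> A; apply: val_inj => /=; have /set_mem [n Nn <-] := valP A.
have [_ [_ _ NV] _ _] := HN.
rewrite (setinv_lcoset HN) // (setmul_lcoset HN) ?mulgV ?lcoset1 //; exact: NV.
Qed.

HB.instance Definition _ := isGroup.Build Q
  quo_mulA quo_mul1 quo_mulr1 quo_mulV quo_mulrV.
HB.instance Definition _ := isPointed.Build Q quo_one.
HB.instance Definition _ := Topological.copy Q (discrete_topology Q).

Lemma quo_continuous (X : topologicalType) (f : Q -> X) : continuous f.
Proof.
move=> q U /nbhs_singleton Ufq.
have sub : [set q] `<=` f @^-1` U by move=> _ ->.
exact: filterS sub (@discrete_set1 (discrete_topology Q) q).
Qed.

Lemma quo_mul_continuous : continuous (fun z : Q * Q => (z.1 * z.2)%g : Q).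
Proof.
move=> [q r] U /nbhs_singleton Uqr.
exists ([set q], [set r]) => /=.
  by split; [exact: (@discrete_set1 (discrete_topology Q))
            |exact: (@discrete_set1 (discrete_topology Q))].
by move=> [_ _] /= [-> ->].
Qed.

HB.instance Definition _ := isTopologicalGroup.Build Q
  quo_mul_continuous (@quo_continuous Q (fun q : Q => q^-1%g : Q)).
End QuotientGroupType.

HB.mixin Record CompleteNormedModule_isCStarAlgebra (R : realType) A
    & CompleteNormedModule (R[i] : numFieldType) A := {
  cmul : A -> A -> A;
  cadj : A -> A;
  cmulA : associative cmul;
  cmulDl : left_distributive cmul +%R;
  cmulDr : right_distributive cmul +%R;
  cmulZl : forall (c : R[i]) a b, cmul (c *: a) b = c *: cmul a b;
  cmulZr : forall (c : R[i]) a b, cmul a (c *: b) = c *: cmul a b;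
  cadjK : involutive cadj;
  cadjD : {morph cadj : a b / a + b};
  cadjZ : forall (c : R[i]) a, cadj (c *: a) = (c^*)%C *: cadj a;
  cadjM : forall a b, cadj (cmul a b) = cmul (cadj b) (cadj a);
  cnormM : forall a b, `|cmul a b| <= `|a| * `|b|;
  cnormS : forall a, `|cmul (cadj a) a| = `|a| ^+ 2
}.

#[short(type="cstarAlgType")]
HB.structure Definition CStarAlgebra (R : realType) :=
  {A of CompleteNormedModule_isCStarAlgebra R A
      & CompleteNormedModule (R[i] : numFieldType) A}.

Section CStarAlgebras.
Variable R : realType.
Implicit Types A B : cstarAlgType R.

(* Contractivity is automatic for a *-homomorphism of C*-algebras; recording
   it does not restrict the notion. *)
Definition star_hom A B (f : A -> B) :=
  [/\ forall (c : R[i]) a b, f (c *: a + b) = c *: f a + f b,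
      {morph f : a b / cmul a b},
      {morph f : a / cadj a} &
      forall a, `|f a| <= `|a|].

Definition closed_ideal A (J : set A) :=
  [/\ closed J, J 0,
      forall (c : R[i]) a b, J a -> J b -> J (c *: a + b) &
      forall a b, J a -> J (cmul a b) /\ J (cmul b a)].

Definition generated_ideal A (S : set A) : set A :=
  \bigcap_(J in [set J | closed_ideal J /\ S `<=` J]) J.

Definition linear_span (V : lmodType R[i]) (S : set V) : set V :=
  [set v | exists n (c : 'I_n -> R[i]) (w : 'I_n -> V),
     (forall k, S (w k)) /\ v = \sum_k c k *: w k].

Definition automorphic_action (G : groupType) A (Ad : G -> A -> A) :=
  [/\ forall x, star_hom (Ad x) /\ bijective (Ad x),
      Ad 1%g = id &
      forall x y, Ad (x * y)%g = Ad x \o Ad y].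

(* [(A, G, Ad)], with embedding [i], is the minimal automorphic dilation of the
   action [beta] of the semigroup [T] on [B]. *)
Definition minimal_automorphic_dilation (G : groupType) (T : set G) A B
    (Ad : G -> A -> A) (beta : G -> B -> B) (i : B -> A) :=
  [/\ automorphic_action Ad,
      forall t, T t -> Ad t \o i = i \o beta t &
      closure (linear_span (\bigcup_(t in T) (Ad t @^-1` range i))) = setT].

End CStarAlgebras.

Definition borel (X : topGroupType) := g_sigma_algebraType (@open X).

Section GroupCStarAlgebra.
Variables (R : realType) (X : topGroupType).
Implicit Types (mu : {measure set (borel X) -> \bar R}) (K : set X).
Implicit Types f g : X -> R[i].

Definition left_haar mu :=
  [/\ forall x (S : set (borel X)), measurable S -> mu (lcoset (x : X) S) = mu S,
      forall S : set X, compact S -> (mu S < +oo)%E,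
      forall S : set (borel X), measurable S ->
        mu S = ereal_inf [set mu U | U in [set U : set X | open U /\ S `<=` U]],
      forall U : set X, open U ->
        mu U = ereal_sup [set mu S | S in [set S : set X | compact S /\ S `<=` U]] &
      mu setT != 0%E].

(* C_c(K) for an open subgroup K of X, functions being extended by 0 off K. *)
Definition Cc K : set (X -> R[i]) :=
  [set f | [/\ continuous (f : X -> R[i]^o),
               compact (closure [set x | f x != 0]) &
               forall x, ~ K x -> f x = 0]].

Definition cintegral mu K f : R[i] :=
  (\int[mu]_(y in (K : set (borel X))) complex.Re (f y)) +i*
  (\int[mu]_(y in (K : set (borel X))) complex.Im (f y)).

Definition convolution mu K f g : X -> R[i] :=
  fun x => cintegral mu K (fun y => f y * g (y^-1 * x)%g).

(* K is unimodular in every use below, so no modular function occurs. *)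
Definition involution f : X -> R[i] := fun x => ((f x^-1%g)^*)%C.

Definition L1norm mu K f : R[i] :=
  (\int[mu]_(y in (K : set (borel X))) complex.Re `|f y|)%:C.

Definition hilbert_inner (V : completeNormedModType R[i])
    (ip : V -> V -> R[i]) :=
  [/\ forall (c : R[i]) u v w, ip (c *: u + v) w = c * ip u w + ip v w,
      forall u v, ip u v = ((ip v u)^*)%C &
      forall v, ip v v = `|v| ^+ 2].

(* *-representations of C_c(K) by operators on the Hilbert space (V, ip) that
   are norm-decreasing for the L^1 norm, i.e. those of L^1(K). *)
Definition star_rep mu K (V : completeNormedModType R[i])
    (ip : V -> V -> R[i]) (pi : (X -> R[i]) -> V -> V) :=
  forall f, Cc K f ->
  [/\ forall (c : R[i]) u v, pi f (c *: u + v) = c *: pi f u + pi f v,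
      forall u v, ip (pi f u) v = ip u (pi (involution f) v),
      forall v, `|pi f v| <= L1norm mu K f * `|v| &
      forall g, Cc K g ->
        (forall (c : R[i]) v,
           pi (fun x => c * f x + g x) v = c *: pi f v + pi g v) /\
        (forall v, pi (convolution mu K f g) v = pi f (pi g v))].

(* [j] is the canonical map into A = C*(K), the completion of C_c(K) in the
   norm sup {|pi f|}, pi ranging over the *-representations; A is determined
   up to a unique isomorphism, and the values of [j] off C_c(K) are
   irrelevant. *)
Definition group_cstar_algebra mu K (A : cstarAlgType R)
    (j : (X -> R[i]) -> A) :=
  [/\ forall (c : R[i]) f g, Cc K f -> Cc K g ->
        j (fun x => c * f x + g x) = c *: j f + j g,
      forall f g, Cc K f -> Cc K g ->
        j (convolution mu K f g) = cmul (j f) (j g),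
      forall f, Cc K f -> j (involution f) = cadj (j f),
      closure (j @` Cc K) = setT &
      forall f (c : R[i]), Cc K f -> 0 <= c ->
        (`|j f| <= c <->
         forall (V : completeNormedModType R[i]) ip pi,
           @hilbert_inner V ip -> star_rep mu K ip pi ->
           forall v, `|pi f v| <= c * `|v|)].

Definition chi (S : set X) : X -> R[i] := fun x => (\1_S x : R)%:C.
End GroupCStarAlgebra.
Arguments chi R {X} S x.

(* Conjugation by x multiplies the Haar measure by Delta(x)^-1, so this is the
   L^1-isometry induced by the automorphism g |-> x g x^-1. *)
Definition conj_fun (R : realType) (G : groupType) (H : set G)
    (heckeH : hecke_pair H) (x : G) (f : schlichting heckeH -> R[i]) :
    schlichting heckeH -> R[i] :=
  fun g => (Delta R H x)%:C * f ((emb heckeH x)^-1 * g * emb heckeH x)%g.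

(* Main.v *)
Require Import Defs.
From HB Require Import structures.
From mathcomp Require Import all_boot all_order all_algebra finmap complex.
From mathcomp Require Import all_classical all_reals all_analysis.

Set Implicit Arguments.
Unset Strict Implicit.
Unset Printing Implicit Defensive.

Import Order.TTheory GRing.Theory Num.Theory numFieldNormedType.Exports.

Local Open Scope classical_set_scope.
Local Open Scope ring_scope.
Local Open Scope complex_scope.

(* A coset n x \bar H x^-1 is the set of those elements of \bar G that
   move x H to n x H, so everything reduces to the sets [moving c d] of elements
   moving one coset c to another d.
   Counting orbits gives mu(Stab c) / mu(Stab d) as a ratio of two indices; this
   makes Delta multiplicative, hence Ad an action.
   By directedness the groups t^-1 \bar H t with t in T are a neighbourhood base
   of e, so uniform continuity approximates C_c(\bar N) in the L^1 norm by
   combinations of the chi_{n t^-1 \bar H t}, whose images therefore span a dense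
   subspace of C*(\bar N).  Each of these is up to a scalar (Ad t)^-1 applied to
   some i(chi_{mH}), which is minimality, and it is a multiple of its product with
   the projection t^-1 p t, so it lies in the ideal I.
   Finally, for t in T, t n \bar H t^-1 is the disjoint union of the m \bar H with
   m H contained in t n H t^-1, which is Ad t o i = i o beta_t on generators. *)

(** * The action of G on G/H *)

Section CosetAction.
Variables (G : groupType) (H : set G).
Local Notation L := (lcosets H).
Local Notation c0 := (trivial_coset H).

Lemma thetaK x : cancel (theta H x) (theta H x^-1%g).
Proof. by move=> c; rewrite thetaM mulVg theta1. Qed.

Lemma thetaVK x : cancel (theta H x^-1%g) (theta H x).
Proof. by move=> c; rewrite thetaM mulgV theta1. Qed.

Lemma theta_inj x : injective (theta H x).
Proof. exact: can_inj (thetaK x). Qed.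

Lemma val_theta_trivial x : val (theta H x c0) = lcoset x H.
Proof. by rewrite /= lcosetM mulg1. Qed.

Lemma coset_rep (c : L) : exists x, c = theta H x c0.
Proof.
have /set_mem [x _ xc] := valP c.
by exists x; apply: val_inj; rewrite val_theta_trivial.
Qed.

Hypothesis sH : subgroup H.

Lemma lcoset_id h : H h -> lcoset h H = H.
Proof.
have [H1 HM HV] := sH => Hh; apply/seteqP; split=> [_ [k Hk <-]|k Hk].
  exact: HM.
by exists (h^-1 * k)%g; [apply: HM => //; exact: HV|rewrite mulVKg].
Qed.

Lemma theta_trivialP x y : theta H x c0 = theta H y c0 <-> H (y^-1 * x)%g.
Proof.
split=> [xy|Hyx]; first by apply: coset_stab => //; rewrite -thetaM xy thetaK.
apply: (@theta_inj y^-1%g); rewrite thetaM thetaK; apply: val_inj.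
by rewrite val_theta_trivial lcoset_id //= lcoset1.
Qed.

Lemma theta_lcosetP x y : theta H x c0 = theta H y c0 <-> lcoset y H x.
Proof.
rewrite theta_trivialP; split=> [Hyx|[h Hh <-]]; last by rewrite mulKg.
by exists (y^-1 * x)%g; rewrite ?mulVKg.
Qed.

(** The elements moving [c] to [d] form, if there are any, a translate of the stabiliser of [c],
    which is a conjugate of H. The set is then contained in a translate of an H-orbit, finite by the
    Hecke condition. *)
Lemma stab_orbit_finite (c d e : L) : hecke_pair H ->
  finite_set [set theta H z e | z in [set z | theta H z c = d]].
Proof.
move=> heckeH.
have [[z0 z0c]|noz] := pselect (exists z, theta H z c = d); last first.
  rewrite (_ : mkset _ = set0) ?image_set0; first exact: finite_set0.
  by apply/seteqP; split=> z // zc; apply: noz; exists z.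
have [x cE] := coset_rep c.
pose O := [set theta H h (theta H x^-1%g e) | h in H].
apply: (sub_finite_set _ (finite_image (theta H (z0 * x)%g) (horbit_finite _ heckeH))).
move=> _ [z /= zc <-]; exists (theta H (x^-1 * z0^-1 * z * x)%g (theta H x^-1%g e)).
  exists (x^-1 * z0^-1 * z * x)%g => //; apply: coset_stab => //.
  by rewrite -!thetaM -cE zc -z0c thetaK cE thetaK.
by rewrite !thetaM; congr theta; rewrite !mulgA !mulgK mulgV mul1g.
Qed.

(** The orbit of [d] under the stabiliser of [c], taken in [set G] through [val] so that for [c0]
    and xH it equals [double_coset H x]. *)
Definition stab_orbit (c d : L) : set (set G) :=
  [set val (theta H z d) | z in [set z | theta H z c = c]].

(* The index of the stabiliser of [c] and [d] in the stabiliser of [c]. *)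
Definition stab_index c d : nat := #|` fset_set (stab_orbit c d)|%fset.

Lemma finite_stab_orbit c d : hecke_pair H -> finite_set (stab_orbit c d).
Proof.
move=> heckeH.
apply: (sub_finite_set _ (finite_image val (stab_orbit_finite c c d heckeH))).
by move=> _ [z zc <-]; exists (theta H z d) => //; exists z.
Qed.

Lemma stab_index_gt0 c d : hecke_pair H -> (0 < stab_index c d)%N.
Proof.
move=> heckeH; rewrite /stab_index cardfs_gt0; apply/fset0Pn; exists (val d).
rewrite in_fset_set; last exact: finite_stab_orbit.
by apply/mem_set; exists 1%g; rewrite /= ?theta1 ?lcoset1.
Qed.

(** Conjugation by x carries the stabiliser of [c] to that of xc, so left translation by x is a
    bijection between the two orbits. *)
Lemma stab_index_theta x c d : hecke_pair H ->
  stab_index (theta H x c) (theta H x d) = stab_index c d.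
Proof.
move=> heckeH; rewrite /stab_index.
have -> : stab_orbit (theta H x c) (theta H x d) = lcoset x @` stab_orbit c d.
  apply/seteqP; split=> [_ [z /= zc <-]|_ [_ [z /= zc <-] <-]].
    exists (val (theta H (x^-1 * z * x)%g d)).
      by exists (x^-1 * z * x)%g; rewrite //= -!thetaM zc thetaK.
    by rewrite /= !lcosetM !mulgA mulgV mul1g.
  exists (x * z * x^-1)%g; first by rewrite /= -!thetaM thetaK zc.
  by rewrite /= !lcosetM mulgVK.
rewrite fset_set_image; last exact: finite_stab_orbit.
rewrite card_imfset // => A B /(congr1 (lcoset x^-1%g)).
by rewrite !lcosetM mulVg !lcoset1.
Qed.

Lemma hindexE x : hecke_pair H -> hindex H x = stab_index c0 (theta H x c0).
Proof.
move=> heckeH; rewrite /hindex /stab_index; congr (#|` fset_set _|%fset).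
have [H1 _ _] := sH.
apply/seteqP; split=> [_ [h Hh <-]|_ [z /= zc <-]].
  exists h; last by rewrite /= !lcosetM mulg1.
  by apply: val_inj; rewrite val_theta_trivial lcoset_id //= lcoset1.
exists z; first exact: coset_stab.
by rewrite !lcosetM mulg1.
Qed.

End CosetAction.

(** * The Schlichting completion acting on G/H *)

Section SchlichtingAction.
Variables (G : groupType) (H : set G) (heckeH : hecke_pair H).
Local Notation Gb := (schlichting heckeH).
Local Notation L := (lcosets H).
Local Notation c0 := (trivial_coset H).
Local Notation emb := (emb heckeH).
Local Notation bar := (bar heckeH).
Let sH : subgroup H := proj1 heckeH.

Definition gact (g : Gb) (c : L) : L := (val g : MapGH H) c.

(* For c = x H and d = n x H this is the coset n x \bar H x^-1. *)
Definition moving (c d : L) : set Gb := [set g | gact g c = d].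

Lemma gact1 c : gact 1%g c = c. Proof. by []. Qed.
Lemma gactM g h c : gact (g * h)%g c = gact g (gact h c). Proof. by []. Qed.
Lemma gact_emb x c : gact (emb x) c = theta H x c. Proof. by []. Qed.

Lemma gactK g : cancel (gact g) (gact g^-1%g).
Proof. by move=> c; rewrite -gactM mulVg gact1. Qed.

Lemma gactVK g : cancel (gact g^-1%g) (gact g).
Proof. by move=> c; rewrite -gactM mulgV gact1. Qed.

Lemma embM x y : emb (x * y)%g = (emb x * emb y)%g.
Proof. by apply: val_inj; apply/funext => c; rewrite /= thetaM. Qed.

Lemma emb1 : emb 1%g = 1%g.
Proof. by apply: val_inj; apply/funext => c; rewrite /= theta1. Qed.

Lemma embV x : emb x^-1%g = (emb x)^-1%g.
Proof. by apply: (@mulgI _ (emb x)); rewrite -embM !mulgV emb1. Qed.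

Lemma gact_approx g (F : seq L) : exists x, {in F, theta H x =1 gact g}.
Proof. by have /closureGP := set_mem (valP g); apply. Qed.

Lemma nbhs_gact (g : Gb) (F : seq L) :
  nbhs g [set h : Gb | {in F, gact h =1 gact g}].
Proof. by apply/nbhs_sch; exists F. Qed.

Lemma locally_determined_open (F : seq L) (S : set Gb) :
  (forall g h, S g -> {in F, gact h =1 gact g} -> S h) -> open S.
Proof.
move=> SF; rewrite openE => g Sg; apply: filterS (nbhs_gact g F) => h hg.
exact: SF hg.
Qed.

Lemma moving_open c d : open (moving c d).
Proof.
apply: (@locally_determined_open [:: c]) => g h gc hg.
by rewrite /moving /= hg ?inE.
Qed.

Lemma moving_closed c d : closed (moving c d).
Proof.
rewrite -openC; apply: (@locally_determined_open [:: c]) => g h gc hg.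
by rewrite /moving /= hg ?inE.
Qed.

(* [moving c d] embeds in the product of the finite sets of possible images of
   the cosets. *)
Lemma moving_compact c d : compact (moving c d).
Proof.
pose O e := [set theta H z e | z in [set z | theta H z c = d]].
have cptO : @compact (MapGH H) [set f : MapGH H | forall e, O e (f e)].
  apply: (@tychonoff _ (fun=> discrete_topology L)) => e.
  exact: (@finite_compact (discrete_topology L)) (stab_orbit_finite sH _ _ _ heckeH).
move=> F PF Fcd.
have [f [fO fcl]] : [set f : MapGH H | forall e, O e (f e)] `&`
    @cluster (MapGH H) ((val : Gb -> MapGH H) @ F) !=set0.
  apply: cptO; suff : F [set g : Gb | forall e, O e (gact g e)] by [].
  apply: filterS Fcd => g gc e.
  have [z zg] := gact_approx g [:: c; e].
  exists z; first by rewrite /= zg ?inE ?eqxx.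
  by rewrite zg // !inE eqxx orbT.
(* As [f] is a cluster point, every member of the filter contains permutations agreeing with [f] on
   any given finite set. This places [f] in the closure of G, fixes its value at [c], and makes it a
   cluster point in the completion. *)
have approx (S : set Gb) (E : seq L) : F S ->
    exists2 g, S g & {in E, gact g =1 f}.
  move=> FS; have FvS : F [set g | ((val : Gb -> MapGH H) @` S) (val g)].
    by apply: filterS FS => g Sg; exists g.
  have fE : @nbhs _ (MapGH H) f [set h : MapGH H | {in E, h =1 f}].
    by apply/nbhs_MapGH; exists E.
  have [_ [[g Sg <-] gf]] := fcl _ _ FvS fE.
  by exists g.
have fG : closureG H f.
  apply/closureGP => E; have [g _ gf] := approx setT E filterT.
  have [x xg] := gact_approx g E; exists x => e eE.
  by rewrite xg // gf.
exists (SigSub (mem_set fG)); split.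
  have [g gc gf] := approx _ [:: c] Fcd.
  by rewrite /moving /= -gc gf ?inE.
move=> S U FS /nbhs_sch [E EU]; have [g Sg gf] := approx S E FS.
by exists g; split=> //; exact: EU.
Qed.

(** A nonempty [moving c d] is thereby a left coset of the stabiliser of [c]. *)
Lemma moving_stab_eq c d g h : moving c d g -> moving c d h <->
  moving c c (g^-1 * h)%g.
Proof.
rewrite /moving /= gactM => gc; split=> [->|/(congr1 (gact g))].
  by rewrite -gc gactK.
by rewrite gactVK gc.
Qed.

(** The stabiliser of the trivial coset in G is H, so an element of G that approximates g on a
    finite set containing [c0] lies in H as soon as g fixes [c0]. *)
Lemma bar_stab : bar H = moving c0 c0.
Proof.
apply/seteqP; split=> g.
  move=> /closure_MapGH /(_ [:: c0]) [_ [h Hh <-] hg].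
  rewrite /moving /= /gact -hg ?inE // -{2}(theta1 c0).
  by apply/theta_trivialP; rewrite // invg1 mul1g.
move=> gc; apply/closure_MapGH => F.
have [h hg] := gact_approx g (c0 :: F).
exists (theta H h); last by move=> c cF; rewrite hg // inE cF orbT.
by exists h => //; apply: coset_stab => //; rewrite hg ?mem_head.
Qed.

Lemma lcoset_moving x c d :
  lcoset (emb x) (moving c d) = moving c (theta H x d).
Proof.
apply/seteqP; split=> [_ [g <- <-]|g gc]; first by rewrite /moving /= gactM.
exists (emb x^-1 * g)%g; last by rewrite embV mulVKg.
by rewrite /moving /= gactM gc gact_emb thetaK.
Qed.

Variable N : set G.
Hypothesis (HN : normal_subgroup H N) (NG : normal_subgroup N [set: G]).

Let normalN n x : N n -> N (x * n * x^-1)%g.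
Proof. by have [_ _ _] := NG; apply. Qed.

(** Since N contains H, an element of G agreeing at [c0] with some n in N lies in nH, hence in N.
    Membership in the closure is therefore decided at the single coset [c0]. *)
Lemma barNP g : bar N g <-> exists2 n, N n & gact g c0 = theta H n c0.
Proof.
split=> [/closure_MapGH /(_ [:: c0]) [_ [n Nn <-] ng]|[n Nn ng]].
  by exists n; rewrite // ng ?inE.
have [_ [_ NM _] HsN _] := HN.
apply/closure_MapGH => F; have [x xg] := gact_approx g (c0 :: F).
exists (theta H x); last by move=> c cF; rewrite xg // inE cF orbT.
exists x => //; rewrite -(mulVKg n x); apply: NM => //; apply: HsN.
by apply/theta_trivialP => //; rewrite xg ?mem_head.
Qed.

Lemma barN_open : open (bar N).
Proof.
apply: (@locally_determined_open [:: c0]) => g h /barNP[n Nn gn] hg.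
by apply/barNP; exists n; rewrite // hg ?inE.
Qed.

(** With c = xH, an element of G moving c to nc lies in n(xHx^-1), up to conjugation by n, and N is
    normal and contains H. *)
Lemma moving_sub_barN c n : N n -> moving c (theta H n c) `<=` bar N.
Proof.
move=> Nn g gc; have [_ [_ NM _] HsN _] := HN.
have [x cE] := coset_rep c.
have [z zg] := gact_approx g [:: c; c0].
apply/barNP; exists z; last by rewrite zg // !inE eqxx orbT.
have /(@theta_trivialP _ _ sH) Hx : theta H (z * x)%g c0 = theta H (n * x)%g c0.
  by rewrite -!thetaM -cE -gc zg ?mem_head.
have /HsN/(normalN (n * x)%g) := Hx.
rewrite mulVKg => Nz; have := NM _ _ Nz Nn.
by rewrite invgM !mulgA mulgK mulgVK.
Qed.

Lemma barN_moving g c : bar N g -> exists2 n, N n & gact g c = theta H n c.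
Proof.
move=> /closure_MapGH /(_ [:: c]) [_ [n Nn <-] ng].
by exists n; rewrite // ng ?inE.
Qed.

Lemma theta_in_normal x c n : N n ->
  exists2 m, N m & theta H x (theta H n c) = theta H m (theta H x c).
Proof.
move=> Nn; exists (x * n * x^-1)%g; first exact: normalN.
by rewrite !thetaM mulgVK.
Qed.

Lemma moving_conj x c d g :
  moving c d ((emb x)^-1 * g * emb x)%g <->
  moving (theta H x c) (theta H x d) g.
Proof.
rewrite /moving /= !gactM gact_emb -embV gact_emb.
by split=> [<-|->]; rewrite ?thetaVK ?thetaK.
Qed.

Lemma dirsemi1 : dirsemi H 1%g.
Proof. by move=> h Hh; exists h; rewrite // mul1g invg1 mulg1. Qed.

Lemma dirsemiM s t : dirsemi H s -> dirsemi H t -> dirsemi H (s * t)%g.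
Proof.
move=> Ts Tt h /Ts [k /Tt [l Hl <-] <-]; exists l => //.
by rewrite invgM !mulgA.
Qed.

(** Conjugating the inclusion of H in aHa^-1 by y gives the statement inside G; approximation at the
    two cosets involved carries it over to the completion. *)
Lemma moving_dirsemi a y : dirsemi H a ->
  moving (theta H y c0) (theta H y c0) `<=`
  moving (theta H (y * a)%g c0) (theta H (y * a)%g c0).
Proof.
move=> Ta g gy; have [z zg] := gact_approx g [:: theta H y c0; theta H (y * a)%g c0].
rewrite /moving /= -zg ?inE ?eqxx ?orbT // thetaM; apply/theta_trivialP => //.
have /(@theta_trivialP _ _ sH)/Ta [h Hh hE] :
    theta H (z * y)%g c0 = theta H y c0 by rewrite -thetaM zg ?mem_head.
suff -> : ((y * a)^-1 * (z * (y * a)) = h)%g by [].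
have -> : ((y * a)^-1 * (z * (y * a)) = a^-1 * (y^-1 * (z * y)) * a)%g.
  by rewrite invgM !mulgA.
by rewrite -hE !mulgA mulVg mul1g mulgVK.
Qed.

(* The stabiliser of t^-1 H in \bar G is t^-1 \bar H t, a subgroup of \bar H. *)
Definition small_coset (c : L) := exists2 t, dirsemi H t & c = theta H t^-1%g c0.

Lemma small_coset_sub c : small_coset c -> moving c c `<=` moving c0 c0.
Proof.
by move=> [t Tt ->]; have := @moving_dirsemi t t^-1%g Tt; rewrite mulVg theta1.
Qed.

(** This is the neighbourhood base property of the groups t^-1 \bar H t. A further coset s^-1 t H is
    fixed by the stabiliser of s^-1 H, so it suffices to refine two small cosets to a common one. *)
Lemma small_coset_fix (dirH : directed H) (F : seq L) :
  exists2 c, small_coset c & forall g, moving c c g -> {in F, gact g =1 id}.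
Proof.
elim: F => [|d F [_ [r Tr ->] IHF]].
  by exists (theta H 1^-1%g c0); first by exists 1%g => //; exact: dirsemi1.
have [x dE] := coset_rep d; have [s [t [Ts Tt xE]]] := dirH x.
(* Directedness applied to r s^-1 = a^-1 b gives a common left multiple ar = bs in T; the stabiliser
   of its inverse coset lies in those of both r^-1 H and s^-1 H. *)
have [a [b [Ta Tb rs]]] := dirH (r * s^-1)%g.
have abrs : (a * r = b * s)%g.
  by rewrite -[r](mulgVK s) rs !mulgA mulgV mul1g.
exists (theta H (a * r)^-1%g c0); first by exists (a * r)%g => //; exact: dirsemiM.
move=> g gc e; rewrite inE => /orP[/eqP->|eF]; last first.
  apply: IHF e eF; have := moving_dirsemi Ta gc.
  by rewrite invgM mulgVK.
move: gc; rewrite abrs => /(moving_dirsemi Tb).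
by rewrite invgM mulgVK dE xE => /(moving_dirsemi Tt).
Qed.

End SchlichtingAction.

(** * Haar measure and the modular function *)

Section Haar.
Variables (R : realType) (G : groupType) (H : set G) (heckeH : hecke_pair H).
Local Notation Gb := (schlichting heckeH).
Local Notation L := (lcosets H).
Local Notation c0 := (trivial_coset H).
Local Notation emb := (emb heckeH).
Local Notation bar := (bar heckeH).
Local Notation moving := (@moving _ _ heckeH).
Variable mu : {measure set (borel Gb) -> \bar R}.
Hypotheses (mu_haar : left_haar mu) (mu_bar : mu (bar H) = 1%E).
Let sH : subgroup H := proj1 heckeH.

Lemma measurable_open (X : topGroupType) (U : set X) : open U ->
  measurable (U : set (borel X)).
Proof. by move=> oU; exact: sub_sigma_algebra. Qed.

Lemma measurable_moving c d : measurable (moving c d : set (borel Gb)).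
Proof. by apply: measurable_open; exact: moving_open. Qed.

Lemma mu_moving_fin c d : mu (moving c d) \is a fin_num.
Proof.
have [_ mu_fin _ _ _] := mu_haar.
by rewrite ge0_fin_numE // mu_fin //; exact: moving_compact.
Qed.

Lemma mu_lcoset x (S : set Gb) : measurable (S : set (borel Gb)) ->
  mu (lcoset (emb x) S) = mu S.
Proof. by have [+ _ _ _ _] := mu_haar; apply. Qed.

Lemma mu_moving_theta x c d : mu (moving c (theta H x d)) = mu (moving c d).
Proof. by rewrite -lcoset_moving mu_lcoset //; exact: measurable_moving. Qed.

(** The stabiliser of [c] is cut according to the image of [d]. Each of the finitely many pieces is
    a left translate, by an element of G, of the intersection of the two stabilisers, so all have
    the same measure. *)
Lemma mu_moving_stab c d : mu (moving c c) =
  ((stab_index c d)%:R * fine (mu (moving c c `&` moving d d)))%:E.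
Proof.
pose P e : set Gb := moving c c `&` [set g | val (gact g d) = e].
have finO := finite_stab_orbit sH c d heckeH.
have PE e : stab_orbit c d e ->
    exists2 x, theta H x c = c & P e = moving c c `&` moving d (theta H x d).
  move=> [x xc <-]; exists x => //; apply/seteqP; split=> g [gc gd]; split=> //.
    exact: val_inj.
  by rewrite /= gd.
have mP e : stab_orbit c d e -> measurable (P e : set (borel Gb)).
  by move=> /PE [x _ ->]; apply: measurableI; exact: measurable_moving.
have cE : moving c c = \bigcup_(e in stab_orbit c d) P e.
  apply/seteqP; split=> [g gc|g [e _ []]//].
  exists (val (gact g d)) => //.
  have [x xg] := gact_approx g [:: c; d]; exists x.
    by rewrite /= xg ?mem_head.
  by rewrite xg // !inE eqxx orbT.
rewrite {1}cE measure_fin_bigcup //; last first.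
  by move=> e f _ _ [g [[_ <-] [_ <-]]].
rewrite fsbig_finite //=.
transitivity (\sum_(e <- fset_set (stab_orbit c d)) mu (moving c c `&` moving d d))%E.
  apply: eq_big_seq => e; rewrite in_fset_set // inE => /PE [x xc ->].
  rewrite -[RHS](@mu_lcoset x); last by apply: measurableI; exact: measurable_moving.
  congr (mu _); apply/seteqP; split=> [g [gc gd]|_ [g [gc gd] <-]].
    exists ((emb x)^-1 * g)%g; last by rewrite mulVKg.
    split; rewrite /moving /= gactM ?gc ?gd -embV gact_emb ?thetaK //.
    by rewrite -{1}xc thetaK.
  by split; rewrite /moving /= gactM gact_emb ?gc ?gd.
rewrite -{1}(@fineK _ (mu _)); last first.
  rewrite ge0_fin_numE // (@le_lt_trans _ _ (mu (moving c c))) //.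
    apply: le_measure; rewrite ?inE //; last exact: measurable_moving.
    by apply: measurableI; exact: measurable_moving.
  by rewrite -ge0_fin_numE // mu_moving_fin.
by rewrite sumEFin big_const_seq count_predT iter_addr addr0 mulr_natl.
Qed.

Local Notation m c := (fine (mu (moving c c))).

Lemma mu_moving_ratio c d :
  m c * (stab_index d c)%:R = m d * (stab_index c d)%:R.
Proof.
rewrite (mu_moving_stab c d) (mu_moving_stab d c) setIC /=.
by rewrite mulrC mulrA mulrAC.
Qed.

Lemma mu_moving_trivial : mu (moving c0 c0) = 1%E.
Proof. by rewrite -bar_stab. Qed.

Lemma mu_moving_gt0 c : 0 < m c.
Proof.
have := mu_moving_ratio c c0; rewrite mu_moving_trivial /= mul1r => mc.
have : 0 < m c * (stab_index c0 c)%:R.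
  by rewrite mc ltr0n; exact: stab_index_gt0.
by rewrite pmulr_lgt0 // ltr0n; exact: stab_index_gt0.
Qed.

(** Translation by x turns L(x^-1) into an index in the stabiliser of xH. Then L(x)/L(x^-1) is a
    ratio of the two indices between the stabilisers of H and xH, the first of measure 1. *)
Lemma DeltaE x : Delta R H x = (m (theta H x c0))^-1.
Proof.
rewrite /Delta !hindexE // -(stab_index_theta sH x c0 (theta H x^-1 c0) heckeH).
rewrite thetaVK.
have := mu_moving_ratio (theta H x c0) c0.
rewrite mu_moving_trivial /= mul1r => mE.
have mx := lt0r_neq0 (mu_moving_gt0 (theta H x c0)).
have i0 : (stab_index (theta H x c0) c0)%:R != 0 :> R.
  by rewrite pnatr_eq0 -lt0n stab_index_gt0.
by apply: (mulfI mx); rewrite mulrA mE divff // mulfV.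
Qed.

Lemma Delta_gt0 x : 0 < Delta R H x.
Proof. by rewrite DeltaE invr_gt0 mu_moving_gt0. Qed.

Lemma Delta1 : Delta R H 1%g = 1.
Proof. by rewrite DeltaE theta1 mu_moving_trivial /= invr1. Qed.

Lemma DeltaM x y : Delta R H (x * y)%g = Delta R H x * Delta R H y.
Proof.
rewrite !DeltaE -invfM; congr (_^-1).
(* The indices between the stabilisers of xyH and xH equal those for yH and H, by translation. *)
have := mu_moving_ratio (theta H (x * y)%g c0) (theta H x c0).
rewrite -thetaM !stab_index_theta // => mxy.
have := mu_moving_ratio (theta H y c0) c0.
rewrite mu_moving_trivial /= mul1r => my.
have i0 : (stab_index c0 (theta H y c0))%:R != 0 :> R.
  by rewrite pnatr_eq0 -lt0n stab_index_gt0.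
by apply: (mulIf i0); rewrite mxy -my mulrA.
Qed.

End Haar.

(** * Compactly supported functions and the canonical map to C*(K) *)

Section CompactlySupported.
Variables (R : realType) (X : topGroupType).
Implicit Types (mu : {measure set (borel X) -> \bar R}) (K S : set X).
Implicit Types f g : X -> R[i].

Lemma compact_image_finite (T : choiceType) (p : X -> T) (K : set X) :
  (forall t, open (p @^-1` [set t])) -> compact K -> finite_set (p @` K).
Proof.
move=> op; rewrite compact_cover => cptK.
have [|D _ KD] := cptK T setT (fun t => p @^-1` [set t]) (fun t _ => op t).
  by move=> x _; exists (p x).
apply: (sub_finite_set _ (finite_fset D)) => _ [x Kx <-].
by have [t Dt /= ->] := KD x Kx.
Qed.

Lemma Cc_lin K (c : R[i]) f g : Cc K f -> Cc K g -> Cc K (fun x => c * f x + g x).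
Proof.
move=> [cf sf f0] [cg sg g0]; split.
- move=> x; apply: (@continuousD _ (R[i]^o : normedModType R[i])); last exact: cg.
  apply: (@continuousZ _ (R[i]^o : normedModType R[i]) _ (fun=> c)); last exact: cf.
  exact: cst_continuous.
- apply: (subclosed_compact (@closed_closure _ _) (compactU sf sg)).
  rewrite -closureU; apply: closureS => x /= fgx; have [fx|fx] := eqVneq (f x) 0.
    by right; apply: contra_neq fgx => gx; rewrite fx gx mulr0 addr0.
  by left.
- by move=> x Kx; rewrite f0 // g0 // mulr0 addr0.
Qed.

Lemma chiE S x : chi R S x = (x \in S)%:R.
Proof. by rewrite /chi indicE; case: (x \in S). Qed.

Lemma chi_Cc K S : open S -> closed S -> compact S -> S `<=` K -> Cc K (chi R S).
Proof.
move=> oS cS cptS SK; split.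
- move=> x U /nbhs_singleton Ux; have [Sx|nSx] := pselect (S x).
    have : nbhs x S by exact: open_nbhs_nbhs.
    apply: filterS => y Sy; move: Ux.
    by rewrite /preimage /= !chiE !mem_set.
  have : nbhs x (~` S) by apply: open_nbhs_nbhs; split=> //; rewrite openC.
  apply: filterS => y Sy; move: Ux.
  by rewrite /preimage /= !chiE !memNset.
- apply: (subclosed_compact (@closed_closure _ _) cptS).
  rewrite [in X in _ `<=` X](closure_id S).1 //; apply: closureS => x /=.
  by rewrite chiE; apply: contraPP => nSx; rewrite memNset ?eqxx.
- by move=> x Kx; rewrite chiE memNset // => /SK.
Qed.

(** The integral of a nonnegative function is a supremum over simple functions below it, hence
    monotone without measurability. This spares any measurability argument for error terms. *)
Lemma ge0_le_integral_unmeasurable d (T : measurableType d)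
    (nu : {measure set T -> \bar R}) (D : set T) (f g : T -> \bar R) :
  (forall x, D x -> 0 <= f x <= g x)%E ->
  (\int[nu]_(x in D) f x <= \int[nu]_(x in D) g x)%E.
Proof.
move=> fg; rewrite !ge0_integralE; last 2 first.
- by move=> x /fg /andP[/le_trans h] /h.
- by move=> x /fg /andP[].
apply: ereal_sup_le => _ [h hf <-]; exists h => // x.
apply: le_trans (hf x) _; rewrite /patch; case: ifPn => // /set_mem /fg.
by case/andP.
Qed.

Lemma ReK (z : R[i]) : 0 <= z -> (complex.Re z)%:C = z.
Proof. by case: z => a b; rewrite lecE /= => /andP[/eqP-> _]. Qed.

Lemma L1norm_ge0 mu K f : 0 <= L1norm mu K f.
Proof.
rewrite /L1norm lecR Rintegral_ge0 // => x _.
by rewrite -lecR ReK ?normr_ge0.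
Qed.

Lemma L1norm_le mu K (M : set X) f (e : R) :
  measurable (K : set (borel X)) -> measurable (M : set (borel X)) ->
  mu M \is a fin_num -> 0 <= e -> (forall x, `|f x| <= (e * \1_M x)%:C) ->
  L1norm mu K f <= (e * fine (mu M))%:C.
Proof.
move=> mK mM Mfin e0 fM; rewrite /L1norm lecR /Rintegral.
have int_le : (\int[mu]_(y in (K : set (borel X))) (complex.Re `|f y|)%:E <=
    (e * fine (mu M))%:E)%E.
  apply: (@le_trans _ _ (\int[mu]_(y in (K : set (borel X))) (e%:E * (\1_M y)%:E))%E).
    apply: ge0_le_integral_unmeasurable => x _; apply/andP; split.
      by rewrite lee_fin -lecR ReK ?normr_ge0.
    by rewrite -EFinM lee_fin -lecR ReK ?normr_ge0.
  rewrite ge0_integralZl //; last first.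
    apply/measurable_realfun.measurable_EFinP.
    exact: measurable_realfun.measurable_indic.
  rewrite integral_indic // EFinM fineK // lee_wpmul2l ?lee_fin //.
  by apply: le_measure; rewrite ?inE //; exact: measurableI.
(* The real integral is [fine] of the extended one, and [fine] is monotone only between finite
   values; the bound just proved also gives finiteness. *)
rewrite -[leRHS]/(fine (e * fine (mu M))%:E) fine_le //.
rewrite ge0_fin_numE; first exact: le_lt_trans int_le (ltry _).
by apply: integral_ge0 => x _; rewrite lee_fin -lecR ReK ?normr_ge0.
Qed.

Section Canonical.
Variables (mu : {measure set (borel X) -> \bar R}) (K : set X).
Variables (A : cstarAlgType R) (j : (X -> R[i]) -> A).
Hypothesis Aj : group_cstar_algebra mu K j.

Lemma canonical_lin (c : R[i]) f g : Cc K f -> Cc K g ->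
  j (fun x => c * f x + g x) = c *: j f + j g.
Proof. by have [+ _ _ _ _] := Aj; apply. Qed.

(** Every representation entering the universal norm is bounded by the L^1 norm. *)
Lemma canonical_norm f : Cc K f -> `|j f| <= L1norm mu K f.
Proof.
have [_ _ _ _ jnorm] := Aj => Kf; apply/(jnorm _ _ Kf (L1norm_ge0 _ _ _)).
by move=> V ip pi _ pi_rep v; have [_ _ + _] := pi_rep _ Kf; apply.
Qed.

Lemma Cc0 : Cc K (fun=> 0 : R[i]).
Proof.
split=> //; first by move=> x; exact: cst_continuous.
rewrite (_ : mkset _ = set0) ?closure0; first exact: compact0.
by apply/seteqP; split=> x //=; rewrite eqxx.
Qed.

Lemma canonical0 : j (fun=> 0) = 0.
Proof.
have := canonical_lin 1 Cc0 Cc0; rewrite scale1r.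
rewrite (_ : (fun x => _) = (fun=> 0)); last by apply/funext => x; rewrite mulr0 addr0.
by move=> /(congr1 (fun a => a - j (fun=> 0))); rewrite addrK subrr => <-.
Qed.

Lemma canonicalZ (c : R[i]) f : Cc K f -> j (fun x => c * f x) = c *: j f.
Proof.
move=> Kf; have := canonical_lin c Kf Cc0; rewrite canonical0 addr0 => <-.
by congr j; apply/funext => x; rewrite addr0.
Qed.

Lemma canonicalB f g : Cc K f -> Cc K g -> Cc K (fun x => f x - g x) /\
  j (fun x => f x - g x) = j f - j g.
Proof.
move=> Kf Kg; have fgE : (fun x => f x - g x) = (fun x => -1 * g x + f x).
  by apply/funext => x; rewrite mulN1r addrC.
by rewrite fgE; split; [exact: Cc_lin|rewrite canonical_lin // scaleN1r addrC].
Qed.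

Lemma canonical_sum (I : eqType) (r : seq I) (c : I -> R[i]) (F : I -> X -> R[i]) :
  {in r, forall k, Cc K (F k)} ->
  Cc K (fun x => \sum_(k <- r) c k * F k x) /\
  j (fun x => \sum_(k <- r) c k * F k x) = \sum_(k <- r) c k *: j (F k).
Proof.
elim: r => [_|k r IHr KF].
  rewrite big_nil (_ : (fun x => _) = (fun=> 0)) ?canonical0; last first.
    by apply/funext => x; rewrite big_nil.
  by split; first exact: Cc0.
have [Kr jr] : Cc K (fun x => \sum_(k <- r) c k * F k x) /\
  j (fun x => \sum_(k <- r) c k * F k x) = \sum_(k <- r) c k *: j (F k).
  by apply: IHr => l lr; apply: KF; rewrite inE lr orbT.
rewrite (_ : (fun x => _) = (fun x => c k * F k x + \sum_(k <- r) c k * F k x)).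
  have Kk : Cc K (F k) by apply: KF; rewrite mem_head.
  by split; [exact: Cc_lin|rewrite canonical_lin // jr big_cons].
by apply/funext => x; rewrite big_cons.
Qed.

End Canonical.
End CompactlySupported.

(** * Dense spans and *-homomorphisms *)

Section Span.
Variables (R : realType) (V : lmodType R[i]).

Lemma linear_span_sum (S : set V) (I : eqType) (r : seq I) (c : I -> R[i])
    (w : I -> V) :
  {in r, forall k, S (w k)} -> linear_span S (\sum_(k <- r) c k *: w k).
Proof.
move=> Sw; exists (size r), (fun k => c (tnth (in_tuple r) k)),
  (fun k => w (tnth (in_tuple r) k)); split; last by rewrite big_tnth.
by move=> k; apply: Sw; rewrite -{2}[r]/(tval (in_tuple r)) mem_tnth.
Qed.

End Span.

Section StarHom.
Variable R : realType.
Implicit Types A B C : cstarAlgType R.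

Lemma star_hom0 A B (f : A -> B) : star_hom f -> f 0 = 0.
Proof.
move=> [flin _ _ _]; have := flin 1 0 0; rewrite !scale1r addr0.
by move/(congr1 (fun b => b - f 0)); rewrite addrK subrr.
Qed.

Lemma star_homZ A B (f : A -> B) c a : star_hom f -> f (c *: a) = c *: f a.
Proof.
by move=> fhom; have [flin _ _ _] := fhom; rewrite -[c *: a]addr0 flin star_hom0 ?addr0.
Qed.

Lemma star_homD A B (f : A -> B) a b : star_hom f -> f (a + b) = f a + f b.
Proof. by move=> [flin _ _ _]; rewrite -{1}[a]scale1r flin scale1r. Qed.

Lemma star_homB A B (f : A -> B) a b : star_hom f -> f (a - b) = f a - f b.
Proof. by move=> fhom; rewrite star_homD // -scaleN1r star_homZ // scaleN1r. Qed.

Lemma star_hom_sum A B (f : A -> B) I (r : seq I) (F : I -> A) : star_hom f ->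
  f (\sum_(k <- r) F k) = \sum_(k <- r) f (F k).
Proof.
move=> fhom; elim: r => [|k r IHr]; first by rewrite !big_nil star_hom0.
by rewrite !big_cons star_homD // IHr.
Qed.

Lemma star_hom_id A : star_hom (@id A).
Proof. by split. Qed.

Lemma star_hom_comp A B C (f : B -> C) (g : A -> B) :
  star_hom f -> star_hom g -> star_hom (f \o g).
Proof.
move=> [f1 f2 f3 f4] [g1 g2 g3 g4]; split=> [c a b|a b|a|a] /=.
- by rewrite g1 f1.
- by rewrite g2 f2.
- by rewrite g3 f3.
- exact: le_trans (f4 _) (g4 _).
Qed.

(** If f(a) and g(a) were at distance r > 0, a point v of the span within r/2 of a would give r < r,
    because f and g are contractive and agree at v. *)
Lemma star_hom_eq A B (f g : A -> B) (S : set A) : star_hom f -> star_hom g ->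
  closure (linear_span S) = setT -> (forall a, S a -> f a = g a) -> f = g.
Proof.
move=> fhom ghom Sdense fgS; apply/funext => a; apply/eqP; rewrite -subr_eq0 -normr_eq0.
apply: contraT => fga; set r := `|_| in fga.
have r_gt0 : 0 < r / 2 by rewrite divr_gt0 // lt_neqAle eq_sym fga normr_ge0.
have : closure (linear_span S) a by rewrite Sdense.
move=> /(_ _ (nbhsx_ballx a _ r_gt0)) [_ [[n [c [w [Sw ->]]]]]].
set v := \sum_k _; rewrite -ball_normE /= => av.
have fgv : f v = g v.
  by rewrite !star_hom_sum //; apply: eq_bigr => k _; rewrite !star_homZ // fgS.
have : r < r / 2 + r / 2.
  have rE : r = `|f (a - v) - g (a - v)|.
    by rewrite (star_homB _ _ fhom) (star_homB _ _ ghom) fgv opprB addrA addrNK.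
  rewrite {1}rE; apply: (le_lt_trans (ler_normB _ _)).
  have [_ _ _ fn] := fhom; have [_ _ _ gn] := ghom.
  by apply: ltrD; [exact: le_lt_trans (fn _) av|exact: le_lt_trans (gn _) av].
by rewrite -splitr ltxx.
Qed.

Lemma closed_ideal_span A (J S : set A) : closed_ideal J -> S `<=` J ->
  closure (linear_span S) = setT -> J = setT.
Proof.
move=> [Jcl J0 Jlin _] SJ Sdense; apply/seteqP; split=> // a _; apply: Jcl.
have : closure (linear_span S) a by rewrite Sdense.
apply: closureS => _ [n [c [w [Sw ->]]]].
apply: (big_ind J) => // [x y Jx Jy|k _].
  by rewrite -[x]scale1r; apply: Jlin.
by rewrite -[_ *: _]addr0; apply: Jlin => //; exact/SJ.
Qed.

Lemma closed_idealZ A (J : set A) c a : closed_ideal J -> J a -> J (c *: a).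
Proof. by move=> [_ J0 Jlin _] Ja; rewrite -[_ *: _]addr0; exact: Jlin. Qed.

End StarHom.

Section SumChi.
Variables (R : realType) (X : topGroupType) (I : eqType).

Lemma sum_chi (r : seq I) (a : I -> R[i]) (S : I -> set X) x k : uniq r ->
  k \in r -> S k x -> (forall l, l \in r -> S l x -> l = k) ->
  \sum_(l <- r) a l * chi R (S l) x = a k.
Proof.
move=> ur kr Skx Sl; rewrite (bigD1_seq k) //= chiE mem_set // mulr1.
rewrite big_seq_cond big1 ?addr0 // => l /andP[lr lk].
by rewrite chiE memNset ?mulr0 // => /(Sl _ lr) lkE; rewrite lkE eqxx in lk.
Qed.

Lemma sum_chi0 (r : seq I) (a : I -> R[i]) (S : I -> set X) x :
  (forall l, l \in r -> ~ S l x) -> \sum_(l <- r) a l * chi R (S l) x = 0.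
Proof.
move=> Sl; rewrite big_seq big1 // => l /Sl nSl.
by rewrite chiE memNset // mulr0.
Qed.

End SumChi.

(** * Approximation in C*(N) *)

Section Density.
Variables (R : realType) (G : groupType) (H N : set G) (heckeH : hecke_pair H).
Local Notation Gb := (schlichting heckeH).
Local Notation L := (lcosets H).
Local Notation c0 := (trivial_coset H).
Local Notation emb := (emb heckeH).
Local Notation bar := (bar heckeH).
Local Notation moving := (@moving _ _ heckeH).
Local Notation gact := (@gact _ _ heckeH).
Variable mu : {measure set (borel Gb) -> \bar R}.
Hypotheses (mu_haar : left_haar mu) (mu_bar : mu (bar H) = 1%E).
Hypotheses (HN : normal_subgroup H N) (NG : normal_subgroup N [set: G]).
Hypothesis dirH : directed H.
Variables (A : cstarAlgType R) (jA : (Gb -> R[i]) -> A).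
Hypothesis A_cstar : group_cstar_algebra mu (bar N) jA.
Let sH : subgroup H := proj1 heckeH.

Lemma chi_moving_Cc c n : N n -> Cc (bar N) (chi R (moving c (theta H n c))).
Proof.
move=> Nn; apply: chi_Cc.
- exact: moving_open.
- exact: moving_closed.
- by apply: moving_compact.
- exact: (moving_sub_barN HN NG).
Qed.

Definition small_generators : set A :=
  [set a | exists n c, [/\ N n, small_coset c &
     a = jA (chi R (moving c (theta H n c)))]].

(** These sets generate a filter on cosets that formalises smallness of the stabiliser, so that
    compactness can be used in its near-covering form. *)
Definition fixators (F : seq L) : set L :=
  [set c | forall k, moving c c k -> {in F, gact k =1 id}].

Lemma fixators_filter : Filter (filter_from setT fixators).
Proof.
apply: filter_from_filter; first by exists [::].
move=> F1 F2 _ _; exists (F1 ++ F2) => // c cF.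
by split=> k kc d dF; apply: cF kc _ _; rewrite mem_cat dF ?orbT.
Qed.

Lemma uniform_continuity (f : Gb -> R[i]) (C : set Gb) (e : R) :
  continuous (f : Gb -> R[i]^o) -> compact C -> 0 < e ->
  exists2 c, small_coset c &
    forall g h, C g -> gact h c = gact g c -> `|f h - f g| <= e%:C.
Proof.
move=> cf /compact_near_coveringP cptC e0.
have e2 : 0 < (e / 2)%:C :> R[i] by rewrite ltcR divr_gt0.
pose P c g := forall h, gact h c = gact g c -> `|f h - f g| <= e%:C.
have [g Cg|F _ FP] := cptC _ _ P fixators_filter.
  have /nbhs_sch [F FU] : nbhs g [set h | `|f h - f g| < (e / 2)%:C].
    have /cvgr_dist_lt /(_ _ e2) := cf g.
    by apply: filterS => h; rewrite distrC.
  exists ([set h : Gb | {in F, gact h =1 gact g}], fixators F).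
    by split; [exact: nbhs_gact|exists F].
  move=> [g' c] [/= g'g cF] h hc.
  have g'h : moving c (gact g' c) g' by [].
  (* Since [g'^-1 * h] stabilises [c], it fixes [F] pointwise; hence [h] agrees on [F] with [g'],
     and so with [g]. *)
  have /cF kF := (moving_stab_eq h g'h).1 hc.
  have hg : {in F, gact h =1 gact g}.
    by move=> d dF; rewrite -g'g // -[in RHS](kF d dF) -gactM mulVKg.
  rewrite -(subrKA (f g)) (le_trans (ler_normD _ _)) // (splitr e) rmorphD /=.
  by apply: lerD; apply: ltW; last rewrite distrC; apply: FU.
have [c small_c cF] := small_coset_fix heckeH dirH F.
by exists c => // g h Cg; apply: FP.
Qed.

Lemma image_trivial_finite c (C : set Gb) : compact C -> finite_set ((gact^~ c) @` C).
Proof. by apply: compact_image_finite => d; exact: moving_open. Qed.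

Lemma bigcup_moving_fin c (D : set L) : finite_set D ->
  measurable (\bigcup_(d in D) moving c d : set (borel Gb)) /\
  mu (\bigcup_(d in D) moving c d) \is a fin_num.
Proof.
move=> finD; split.
  by apply: measurable_open; apply: bigcup_open => d _; exact: moving_open.
have [_ mu_fin _ _ _] := mu_haar.
rewrite ge0_fin_numE // mu_fin // -bigsetU_fset_set //.
by apply: bigsetU_compact => d _; exact: moving_compact.
Qed.

(** The approximant is a step function, equal on each coset of a small stabiliser meeting the
    support to the value of [f] at a representative. The error is carried by a union of cosets of
    \bar H that does not depend on [e], so its L^1 norm tends to 0 with [e]. *)
Lemma approx_small_generators (f : Gb -> R[i]) (e : R) :
  Cc (bar N) f -> 0 < e ->
  exists s : Gb -> R[i],
    [/\ Cc (bar N) s, linear_span small_generators (jA s) &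
        forall x, `|f x - s x| <=
          (e * \1_(\bigcup_(d in (gact^~ c0) @` closure [set x | f x != 0])
                     moving c0 d) x)%:C].
Proof.
move=> [cf cptC f0] e0; set C := closure _ in cptC *.
have [c small_c cP] := uniform_continuity cf cptC e0.
pose D := (gact^~ c) @` C; have finD : finite_set D by exact: image_trivial_finite.
pose r d := xget 1%g [set g | C g /\ gact g c = d].
have rP d : D d -> C (r d) /\ gact (r d) c = d.
  by move=> [g Cg gd]; rewrite /r; case: xgetP => [h _ //|/(_ g)[]].
(* The representative is only in the closure of the nonvanishing set; as [moving c d] is open, it
   also contains a point where [f] is nonzero, and such a point lies in \bar N. *)
have DN d : d \in fset_set D -> exists2 n, N n & d = theta H n c.
  rewrite in_fset_set // inE => /rP [Cr rd].
  have [g [fg gd]] := Cr _ (open_nbhs_nbhs (conj (@moving_open _ _ heckeH c d) rd)).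
  have /(@barN_moving _ _ _ _ _ c) [n Nn gn] : bar N g.
    by apply: contrapT => /f0 /eqP; apply/negP.
  by exists n; rewrite // -gn.
exists (fun x => \sum_(d <- fset_set D) f (r d) * chi R (moving c d) x).
have FD : {in fset_set D, forall d, Cc (bar N) (chi R (moving c d))}.
  by move=> d /DN [n Nn ->]; exact: chi_moving_Cc.
have [Cs js] := canonical_sum A_cstar (fun d => f (r d)) FD.
split=> //.
  rewrite js; apply: linear_span_sum => d /DN [n Nn ->].
  by exists n, c; split.
move=> x; have [Dx|nDx] := pselect (D (gact x c)); last first.
  rewrite sum_chi0 ?subr0 => [|d]; last first.
    by rewrite in_fset_set // inE => Dd xd; apply: nDx; rewrite xd.
  have -> : f x = 0.
    apply/eqP; apply: contrapT => fx; apply: nDx; exists x => //.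
    by apply: subset_closure; exact/negP.
  by rewrite normr0 lecR mulr_ge0 ?(ltW e0) // indicE ler0n.
have [Cr rx] := rP _ Dx.
have kD : gact x c \in fset_set D by rewrite in_fset_set ?inE.
rewrite (@sum_chi _ _ _ _ (fun d => f (r d)) (moving c) x _ (fset_uniq _) kD) //.
apply: le_trans (cP _ x Cr (esym rx)) _.
rewrite indicE mem_set ?mulr1 //.
(* The small stabiliser lies in \bar H, so [x] and its representative share a coset of \bar H and
   the former lies in the error set. *)
have /small_coset_sub kc : small_coset c by [].
have g0 : moving c0 (gact (r (gact x c)) c0) (r (gact x c)) by [].
exists (gact (r (gact x c)) c0); first by exists (r (gact x c)).
by apply/(moving_stab_eq x g0); apply: kc; apply/(moving_stab_eq x rx).
Qed.

Lemma small_generators_dense : closure (linear_span small_generators) = setT.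
Proof.
have [_ _ _ jdense _] := A_cstar.
apply/seteqP; split=> // a _; apply: closed_closure.
have : closure (jA @` Cc (bar N)) a by rewrite jdense.
apply: closureS => _ [f Kf <-] B /nbhs_ballP [z /= z0 zB].
have [_ cptC _] := Kf.
have [mM Mfin] := bigcup_moving_fin c0 (image_trivial_finite c0 cptC).
set M := bigcup _ _ in mM Mfin.
have m0 : 0 <= fine (mu M) by exact: fine_ge0.
(* Radii of balls are elements of [R[i]]; a positive one equals its real part. *)
have zE : (complex.Re z)%:C = z by rewrite ReK // ltW.
have z'0 : 0 < complex.Re z by rewrite -ltcR zE.
(* Adding 1 keeps the denominator positive when the error set is null and makes the final inequality
   strict. *)
have e0 : 0 < complex.Re z / (fine (mu M) + 1) by rewrite divr_gt0 // ltr_wpDl.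
have [s [Ks js fs]] := approx_small_generators Kf e0.
exists (jA s); split=> //; apply: zB; rewrite -ball_normE /=.
have [Kfs <-] := canonicalB A_cstar Kf Ks.
apply: le_lt_trans (canonical_norm A_cstar Kfs) _.
apply: le_lt_trans (L1norm_le _ mM Mfin (ltW e0) fs) _.
  by apply: measurable_open; exact: (barN_open _ HN).
rewrite -zE ltcR -mulrA gtr_pMr // mulrC ltr_pdivrMr ?ltr_wpDl //.
by rewrite mul1r ltrDl.
Qed.

End Density.

(** * The dilation *)

Section QuotientAlgebra.
Variables (R : realType) (G : groupType) (H N : set G) (HN : normal_subgroup H N).
Local Notation Q := (quotient_group HN).
Variables (B : cstarAlgType R) (jB : (Q -> R[i]) -> B).
Hypothesis B_cstar : group_cstar_algebra (@counting (borel Q) R) [set: Q] jB.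

Lemma quo_open (S : set Q) : open S.
Proof. exact: (@discrete_open (discrete_topology Q)). Qed.

Lemma chi_quo_Cc (k : Q) : Cc setT (chi R [set k]).
Proof.
apply: chi_Cc => //; first exact: quo_open.
  by rewrite -openC; exact: quo_open.
exact: finite_compact.
Qed.

(** N/H is discrete, so compact supports are finite and every function in [Cc] is a finite
    combination of point masses. *)
Lemma chi_quo_dense :
  closure (linear_span (range (fun k : Q => jB (chi R [set k])))) = setT.
Proof.
have [_ _ _ jdense _] := B_cstar.
apply/seteqP; split=> // b _.
have : closure (jB @` Cc setT) b by rewrite jdense.
apply: closureS => _ [f Kf <-].
have [_ cptf _] := Kf; set C := closure _ in cptf.
have finC : finite_set C.
  by rewrite -[C]image_id; apply: compact_image_finite => // t; exact: quo_open.
have [_ js] := @canonical_sum _ _ _ _ _ _ B_cstar _ (fset_set C) f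
  (fun k => chi R [set k]) (fun k _ => chi_quo_Cc k).
have -> : f = (fun x => \sum_(k <- fset_set C) f k * chi R [set k] x).
  apply/funext => x; have [Cx|nCx] := pselect (C x).
    rewrite (@sum_chi _ _ _ _ f (fun k => [set k]) x x (fset_uniq _)) //.
    by rewrite in_fset_set ?inE.
  rewrite sum_chi0 => [|k]; last first.
    by rewrite in_fset_set // inE => Ck xk; apply: nCx; rewrite xk.
  apply/eqP; apply: contrapT => fx; apply: nCx.
  by apply: subset_closure; exact/negP.
by rewrite js; apply: linear_span_sum => k _; exists k.
Qed.

End QuotientAlgebra.

Section Dilation.
Variables (R : realType) (G : groupType) (H N : set G) (heckeH : hecke_pair H).
Local Notation Gb := (schlichting heckeH).
Local Notation L := (lcosets H).
Local Notation c0 := (trivial_coset H).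
Local Notation emb := (emb heckeH).
Local Notation bar := (bar heckeH).
Local Notation moving := (@moving _ _ heckeH).
Local Notation gact := (@gact _ _ heckeH).
Variable mu : {measure set (borel Gb) -> \bar R}.
Hypotheses (mu_haar : left_haar mu) (mu_bar : mu (bar H) = 1%E).
Hypotheses (HN : normal_subgroup H N) (NG : normal_subgroup N [set: G]).
Hypothesis dirH : directed H.
Variables (A : cstarAlgType R) (jA : (Gb -> R[i]) -> A).
Hypothesis A_cstar : group_cstar_algebra mu (bar N) jA.
Let sH : subgroup H := proj1 heckeH.
Variable Ad : G -> A -> A.
Hypothesis Ad_hom : forall x, star_hom (Ad x).
Hypothesis Ad_conj : forall x f, Cc (bar N) f -> Ad x (jA f) = jA (conj_fun x f).
Local Notation Dl x := ((Delta R H x)%:C : R[i]).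
Local Notation jm c d := (jA (chi R (moving c d))).

Lemma Delta_neq0 x : Dl x != 0.
Proof.
rewrite -(rmorph0 (real_complex R)) (inj_eq (@complexI R)) gt_eqF //.
exact: Delta_gt0 mu_haar mu_bar _.
Qed.

Lemma Ad_moving x c n : N n ->
  Ad x (jm c (theta H n c)) = Dl x *: jm (theta H x c) (theta H x (theta H n c)).
Proof.
move=> Nn; rewrite Ad_conj; last exact: chi_moving_Cc.
rewrite -(canonicalZ A_cstar); last first.
  by have [m Nm ->] := theta_in_normal NG x c Nn; exact: chi_moving_Cc.
congr jA; apply/funext => g; rewrite /conj_fun !chiE; congr (_ * _%:R).
by congr nat_of_bool; apply/idP/idP => /set_mem gm; apply/mem_set; apply/moving_conj.
Qed.

(** Both action laws compare *-homomorphisms, so they need checking only on [small_generators],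
    where they reduce to the multiplicativity of [Delta]. Bijectivity follows, with inverse
    [Ad x^-1]. *)
Lemma Ad_action : automorphic_action Ad.
Proof.
have Wdense := small_generators_dense mu_haar HN NG dirH A_cstar.
have Ad1 : Ad 1%g = id.
  apply: (star_hom_eq (Ad_hom _) (@star_hom_id _ A) Wdense) => _ [n [c [Nn _ ->]]].
  by rewrite Ad_moving // !theta1 (Delta1 mu_haar mu_bar) scale1r.
have AdM x y : Ad (x * y)%g = Ad x \o Ad y.
  apply: (star_hom_eq (Ad_hom _) _ Wdense); first exact: star_hom_comp.
  move=> _ [n [c [Nn _ ->]]] /=; rewrite !Ad_moving // star_homZ //.
  have [m Nm mE] := theta_in_normal NG y c Nn.
  rewrite mE Ad_moving // -mE !thetaM scalerA (DeltaM mu_haar mu_bar) rmorphM.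
  by rewrite [Dl x * _]mulrC.
split=> // x; split; first exact: Ad_hom.
by exists (Ad x^-1%g) => a; rewrite -[LHS]/((Ad _ \o Ad _) a) -AdM ?mulVg ?mulgV Ad1.
Qed.

(** For K the stabiliser of [c] and a coset gK, the integrand at y is 1 exactly when both y and x
    lie in gK. *)
Lemma convolution_moving c d : moving c d `<=` bar N ->
  convolution mu (bar N) (chi R (moving c d)) (chi R (moving c c)) =
  (fun x => (fine (mu (moving c d)))%:C * chi R (moving c d) x).
Proof.
move=> cdN; apply/funext => x.
have chiM y : chi R (moving c d) y * chi R (moving c c) (y^-1 * x)%g =
    (\1_(moving c d) y * \1_(moving c d) x)%:C.
  rewrite !chiE !indicE; have [yc|nyc] := pselect (moving c d y); last first.
    by rewrite (memNset nyc) !mul0r.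
  rewrite (mem_set yc) !mul1r; have [xc|nxc] := pselect (moving c d x).
    by rewrite !mem_set //; apply/(moving_stab_eq x yc).
  by rewrite !memNset // => /(moving_stab_eq x yc).
have mN : measurable (bar N : set (borel Gb)).
  by apply: measurable_open; exact: (barN_open _ HN).
rewrite /convolution (_ : (fun y => _) =
  (fun y => (\1_(moving c d) y * \1_(moving c d) x)%:C)); last exact/funext.
rewrite /cintegral /= {2}/Rintegral integral0 /Rintegral.
have [xc|nxc] := pselect (moving c d x).
  rewrite chiE !indicE (mem_set xc) mulr1 -[in RHS](setIidl cdN).
  rewrite -integral_indic //; last exact: measurable_moving.
  by congr ((fine _)%:C); apply: eq_integral => y _; rewrite mulr1.
rewrite chiE !indicE (memNset nxc) mulr0 integral0_eq // => y _.
by rewrite mulr0.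
Qed.

Lemma generated_ideal_Ad :
  generated_ideal [set Ad x (jA (chi R (bar H))) | x in [set: G]] = setT.
Proof.
have N1 : N 1%g by have [_ []] := HN.
apply/seteqP; split=> // a _ J [Jid PJ].
suff -> : J = setT by [].
apply: (closed_ideal_span Jid _ (small_generators_dense mu_haar HN NG dirH A_cstar)).
move=> _ [n [c [Nn [t Tt cE] ->]]].
(* For c = t^-1 H, [Ad t^-1] maps p to a nonzero multiple of the indicator of the stabiliser of
   c. *)
have Jc : J (jm c (theta H 1%g c)).
  have := PJ _ (imageP _ (I : [set: G] t^-1%g)).
  rewrite (bar_stab heckeH) -{2}(theta1 c0) Ad_moving // theta1 -cE.
  move=> /(closed_idealZ (Dl t^-1)^-1 Jid).
  by rewrite scalerA mulVf ?Delta_neq0 // scale1r theta1.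
have [_ conv _ _ _] := A_cstar; have [_ _ _ Jmul] := Jid.
have := (Jmul _ (jm c (theta H n c)) Jc).2.
rewrite -conv; [|exact: chi_moving_Cc|exact: chi_moving_Cc].
rewrite theta1 convolution_moving; last exact: (moving_sub_barN HN NG).
rewrite (canonicalZ A_cstar); last exact: chi_moving_Cc.
(* The product with that indicator only rescales the generator, by the measure of a left translate
   of a stabiliser, which is positive. *)
move=> /(closed_idealZ (fine (mu (moving c (theta H n c))))%:C^-1 Jid).
rewrite scalerA mulVf ?scale1r // -(rmorph0 (real_complex R)) (inj_eq (@complexI R)).
by rewrite mu_moving_theta // gt_eqF // mu_moving_gt0.
Qed.

Variables (B : cstarAlgType R) (jB : (quotient_group HN -> R[i]) -> B).
Hypothesis B_cstar : group_cstar_algebra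
  (@counting (borel (quotient_group HN)) R) [set: quotient_group HN] jB.
Variables (beta : G -> B -> B) (i : B -> A).
Hypothesis beta_hom : forall t, dirsemi H t -> star_hom (beta t).
Hypothesis beta_chi : forall t (k : quotient_group HN), dirsemi H t ->
  beta t (jB (chi R [set k])) = Dl t *:
    \sum_(l \in [set l : quotient_group HN | val l `<=` conjset t (val k)])
       jB (chi R [set l]).
Hypothesis i_hom : star_hom i.
Hypothesis i_chi : forall n (k : quotient_group HN), N n -> val k = lcoset n H ->
  i (jB (chi R [set k])) = jA (chi R (lcoset (emb n) (bar H))).
Local Notation Q := (quotient_group HN).

Definition quo_coset (n : G) (Nn : N n) : Q :=
  SigSub (mem_set (ex_intro2 _ _ n Nn (erefl (lcoset n H)))).

Lemma quo_rep (k : Q) : exists2 n, N n & val k = lcoset n H.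
Proof. by have /set_mem [n Nn nk] := valP k; exists n. Qed.

Lemma coset_of_quo_subproof (k : Q) : lcosets H (val k).
Proof. by have [n _ ->] := quo_rep k; exists n. Qed.

Definition coset_of_quo (k : Q) : L := SigSub (mem_set (coset_of_quo_subproof k)).

Lemma coset_of_quoE k n : val k = lcoset n H -> coset_of_quo k = theta H n c0.
Proof. by move=> kn; apply: val_inj; rewrite val_theta_trivial. Qed.

Lemma coset_of_quo_inj : injective coset_of_quo.
Proof. by move=> k l /(congr1 val) kl; exact: val_inj. Qed.

Lemma i_moving (k : Q) : i (jB (chi R [set k])) = jm c0 (coset_of_quo k).
Proof.
have [n Nn kn] := quo_rep k.
by rewrite (i_chi Nn kn) (coset_of_quoE kn) bar_stab lcoset_moving.
Qed.

(** A coset mH inside tnHt^-1 has the form tn(ht^-1 H), a translate by tn of a member of Ht^-1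
    H/H. *)
Lemma conj_subcosets_finite t (k : Q) :
  finite_set [set l : Q | val l `<=` conjset t (val k)].
Proof.
have [n Nn kn] := quo_rep k; have [H1 _ _] := sH.
apply: (@sub_finite_set _ _ ((val : Q -> set G) @^-1`
  (lcoset (t * n)%g @` double_coset H t^-1%g))).
  move=> l /=; have [m Nm ->] := quo_rep l => ml.
  have /ml : lcoset m H m by exists 1%g; rewrite ?mulg1.
  rewrite kn => -[_ [h Hh <-] <-]; exists (lcoset (h * t^-1)%g H); first by exists h.
  by rewrite lcosetM !mulgA.
apply: finite_preimage; first by move=> l l' _ _; exact: val_inj.
by apply: finite_image; have [_] := heckeH; apply.
Qed.

(** An element z of G matching g at H and tH reduces the claim to G. If z is in tnHt^-1, then z is
    in N by normality, and zH stays in tnHt^-1 because H is contained in tHt^-1; conversely mH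
    contains z. *)
Lemma conj_subcosetsP t (k : Q) n g : dirsemi H t -> N n -> val k = lcoset n H ->
  moving (theta H t c0) (theta H t (theta H n c0)) g <->
  exists2 l : Q, val l `<=` conjset t (val k) & moving c0 (coset_of_quo l) g.
Proof.
move=> Tt Nn kn; have [H1 HM _] := sH; have [_ [_ NM _] HsN _] := HN.
have normN x : N x -> N (t * x * t^-1)%g by have [_ _ _] := NG; apply.
have [z zg] := gact_approx g [:: c0; theta H t c0].
have zt : moving (theta H t c0) (theta H t (theta H n c0)) g <->
    H ((t * n)^-1 * (z * t))%g.
  rewrite -(@theta_trivialP _ _ sH) /moving /= -zg ?inE ?eqxx ?orbT //.
  by rewrite !thetaM.
split=> [/zt Ha|[l lk gl]].
  set a := ((t * n)^-1 * (z * t))%g in Ha.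
  have zE : z = (t * (n * a) * t^-1)%g by rewrite (mulgA t) mulVKg mulgK.
  have Nz : N z by rewrite zE; apply: normN; exact: NM (HsN _ Ha).
  exists (quo_coset Nz); last first.
    by rewrite (@coset_of_quoE (quo_coset Nz) z) // /moving /= -zg ?mem_head.
  rewrite kn => _ [h /Tt [b Hb <-] <-]; exists (n * (a * b))%g.
    by exists (a * b)%g => //; exact: HM.
  by rewrite zE !mulgA mulgVK.
have [m Nm lm] := quo_rep l; apply/zt.
have /(@theta_lcosetP _ _ sH) zm : theta H z c0 = theta H m c0.
  by rewrite zg ?mem_head // gl; exact: coset_of_quoE.
rewrite -lm in zm; have := lk _ zm; rewrite kn => -[_ [h Hh <-] <-].
by rewrite invgM !mulgA !mulgVK mulVg mul1g.
Qed.

Lemma Ad_intertwines t : dirsemi H t -> Ad t \o i = i \o beta t.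
Proof.
move=> Tt; apply: (star_hom_eq _ _ (chi_quo_dense B_cstar)).
- exact: star_hom_comp.
- by apply: star_hom_comp => //; exact: beta_hom.
move=> _ [k _ <-] /=; have [n Nn kn] := quo_rep k.
have finP := conj_subcosets_finite t k; set P := [set l | _] in finP *.
rewrite beta_chi // star_homZ // fsbig_finite // star_hom_sum // i_moving.
rewrite (coset_of_quoE kn) Ad_moving //; congr (_ *: _).
have Kl : {in fset_set P, forall l, Cc (bar N) (chi R (moving c0 (coset_of_quo l)))}.
  move=> l _; have [m Nm /coset_of_quoE ->] := quo_rep l; exact: chi_moving_Cc.
under eq_bigr => l _ do rewrite i_moving -[jA _]scale1r.
rewrite -(canonical_sum A_cstar (fun=> 1) Kl).2; congr jA; apply/funext => g.
have [gt|ngt] := pselect (moving (theta H t c0) (theta H t (theta H n c0)) g).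
  have /(conj_subcosetsP g Tt Nn kn) [l Pl gl] := gt.
  rewrite chiE mem_set // (@sum_chi _ _ _ _ (fun=> 1) _ g l (fset_uniq _)) //.
    by rewrite in_fset_set ?inE.
  (* Distinct cosets give disjoint sets [moving c0 _], so exactly one term of the sum is nonzero at
     [g]. *)
  by move=> l' _ gl'; apply: coset_of_quo_inj; rewrite -gl'.
rewrite chiE memNset // sum_chi0 // => l; rewrite in_fset_set // inE => Pl gl.
by apply: ngt; apply/(conj_subcosetsP g Tt Nn kn); exists l.
Qed.

Lemma Ad_minimal :
  closure (linear_span (\bigcup_(t in dirsemi H) (Ad t @^-1` range i))) = setT.
Proof.
apply/seteqP; split=> // a _.
have : closure (linear_span (small_generators N jA)) a.
  by rewrite (small_generators_dense mu_haar HN NG dirH A_cstar).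
apply: closureS => _ [m [z [w [Sw ->]]]]; exists m, z, w; split=> // k.
have [n [c [Nn [t Tt cE] ->]]] := Sw k; exists t => //=.
have [n' Nn' nE] := theta_in_normal NG t c Nn.
(* With c = t^-1 H and n' = tnt^-1, [Ad t] sends the generator to Delta(t) times the indicator of n'
   \bar H, which is in the range of [i]. *)
exists (Dl t *: jB (chi R [set quo_coset Nn'])) => //.
rewrite star_homZ // i_moving Ad_moving // nE cE thetaVK.
by rewrite (@coset_of_quoE (quo_coset Nn') n').
Qed.

End Dilation.

Theorem theorem9p3 (R : realType) (G : groupType) (H N : set G)
    (heckeH : hecke_pair H) (redH : reduced H) (dirH : directed H)
    (HN : normal_subgroup H N) (NG : normal_subgroup N [set: G])
    (mu : {measure set (borel (schlichting heckeH)) -> \bar R})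
    (mu_haar : left_haar mu) (mu_bar : mu (bar heckeH H) = 1%E)
    (A : cstarAlgType R) (jA : (schlichting heckeH -> R[i]) -> A)
    (A_cstar : group_cstar_algebra mu (bar heckeH N) jA)
    (B : cstarAlgType R) (jB : (quotient_group HN -> R[i]) -> B)
    (B_cstar : group_cstar_algebra
       (@counting (borel (quotient_group HN)) R) [set: quotient_group HN] jB)
    (Ad : G -> A -> A) (Ad_hom : forall x, star_hom (Ad x))
    (Ad_conj : forall x f, Cc (bar heckeH N) f ->
       Ad x (jA f) = jA (conj_fun x f))
    (beta : G -> B -> B)
    (beta_hom : forall t, dirsemi H t -> star_hom (beta t))
    (beta_chi : forall t (k : quotient_group HN), dirsemi H t ->
       beta t (jB (chi R [set k])) = (Delta R H t)%:C *:
         \sum_(l \in [set l : quotient_group HN | val l `<=` conjset t (val k)])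
            jB (chi R [set l]))
    (i : B -> A) (i_hom : star_hom i) (i_inj : injective i)
    (i_chi : forall n (k : quotient_group HN), N n -> val k = lcoset n H ->
       i (jB (chi R [set k])) =
       jA (chi R (lcoset (emb heckeH n) (bar heckeH H)))) :
  generated_ideal [set Ad x (jA (chi R (bar heckeH H))) | x in [set: G]] = setT
  /\ minimal_automorphic_dilation (dirsemi H) Ad beta i.
Proof.
split; first exact: (generated_ideal_Ad mu_haar mu_bar HN NG dirH A_cstar Ad_conj).
split.
- exact: (Ad_action mu_haar mu_bar HN NG dirH A_cstar Ad_hom Ad_conj).
- move=> t Tt; exact: (Ad_intertwines NG A_cstar Ad_hom Ad_conj B_cstar beta_hom
    beta_chi i_hom i_chi Tt).
- exact: (Ad_minimal mu_haar NG dirH A_cstar Ad_conj i_hom i_chi).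
Qed.
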